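(* Let $k$ be an algebraically closed field, let $A$ be the (three-dimensional) arrow space of the $3$-Kronecker quiver $K(3)$, and let $\tau:\mathbb Z^2\to\mathbb Z^2$, $\tau(x,y)=(8x-3y,\,3x-y)$. Then the following hold. (1) The dimension vectors of the elementary $3$-Kronecker modules are precisely the elements of the $\tau$-orbits of $(1,1)$, $(2,1)$, $(2,2)$ and $(4,2)$ in $\mathbb Z^2$. (2) Any indecomposable $3$-Kronecker module whose dimension vector lies in the $\tau$-orbit of $(1,1)$ or in the $\tau$-orbit of $(2,1)$ is elementary. (3) An indecomposable $3$-Kronecker module with dimension vector $(2,2)$ (respectively $(4,2)$) is elementary if and only if it is isomorphic to $X(\alpha,\beta,\gamma)$ (respectively $Y(\alpha,\beta,\gamma)$) for some basis $\alpha,\beta,\gamma$ of $A$.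
   Context: The $3$-Kronecker quiver $K(3)$ has two vertices $1,2$ and three arrows $1\to 2$. Its arrow space $A$ is the three-dimensional $k$-vector space with basis the arrows, and its path algebra is $\Lambda=\begin{bmatrix}k&A\\0&k\end{bmatrix}$. A $3$-Kronecker module is a finite-dimensional $\Lambda$-module, i.e. a pair of finite-dimensional vector spaces $M_1,M_2$ with a linear map $A\otimes_k M_1\to M_2$; after choosing a basis $\alpha,\beta,\gamma$ of $A$ it is a representation $(M_1,M_2;\alpha,\beta,\gamma)$ with three linear maps $M_1\to M_2$. The dimension vector is $(\dim M_1,\dim M_2)$. A module $M$ is preprojective if there are only finitely many isomorphism classes of indecomposable modules $X$ with $\operatorname{Hom}(X,M)\ne0$; preinjective if there are only finitely many isomorphism classes of indecomposable $X$ with $\operatorname{Hom}(M,X)\ne 0$; regular if it has no indecomposable direct summand which is preprojective or preinjective. A module $M$ is elementary if it is non-zero, regular, and there is no short exact sequence $0\to M'\to M\to M''\to 0$ with $M',M''$ non-zero regular modules. The map $\tau$ on $\mathbb Z^2$ is bijective, and the $\tau$-orbit of $(x,y)$ is $\{\tau^t(x,y)\mid t\in\mathbb Z\}$. (It satisfies $\tau=\sigma^2$ with $\sigma(x,y)=(3x-y,x)$.) For a basis $\alpha,\beta,\gamma$ of $A$: $X(\alpha,\beta,\gamma)$ is the module with $M_1$ having basis $u_1,u_2$, $M_2$ having basis $w_1,w_2$, and $\alpha u_1=w_1$, $\alpha u_2=w_2$, $\beta u_1=0$, $\beta u_2=w_1$, $\gamma u_1=w_2$, $\gamma u_2=0$.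 The module $Y(\alpha,\beta,\gamma)$ has $M_1$ with basis $u_0,u_1,u_2,u_3$, $M_2$ with basis $w_1,w_2$, and the nonzero values on basis vectors are $\alpha u_1=w_1$, $\alpha u_2=w_2$, $\beta u_2=w_1$, $\beta u_3=w_2$, $\gamma u_0=w_1$, $\gamma u_1=w_2$ (all other values of $\alpha,\beta,\gamma$ on these basis vectors are $0$). *)

(* Defs.v *)
From HB Require Import structures.
From mathcomp Require Import all_boot all_order all_algebra.
From mathcomp Require Import ring.

Set Implicit Arguments.
Unset Strict Implicit.
Unset Printing Implicit Defensive.

Import GRing.Theory.
Local Open Scope ring_scope.

(* The arrows are the standard basis vectors of [arrow_space k]. *)
Notation arrow_space k := 'rV[k]_3.

(* The bilinear map A x M_1 -> M_2 encodes the linear map A (x) M_1 -> M_2. *)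
Record kmod (k : fieldType) := KMod {
  sp1 : vectType k;
  sp2 : vectType k;
  act : 'Hom(arrow_space k, 'Hom(sp1, sp2)) }.

Record khom (k : fieldType) (M N : kmod k) := KHom {
  hom1 : 'Hom(sp1 M, sp1 N);
  hom2 : 'Hom(sp2 M, sp2 N);
  hom_act : forall (a : arrow_space k) (u : sp1 M),
    hom2 (act M a u) = act N a (hom1 u) }.

Section Modules.

Variable k : fieldType.
Implicit Types M N X Y : kmod k.

Definition dim_vector M : int * int :=
  ((\dim {: sp1 M})%:Z, (\dim {: sp2 M})%:Z).

Definition kzero M : Prop := \dim {: sp1 M} = 0%N /\ \dim {: sp2 M} = 0%N.

Definition hom_nonzero M N : Prop :=
  exists f : khom M N, hom1 f <> 0 \/ hom2 f <> 0.

Definition kiso M N : Prop :=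
  exists f : khom M N, bijective (hom1 f) /\ bijective (hom2 f).

Definition ksum_act M N (a : arrow_space k) (u : sp1 M * sp1 N) :
  sp2 M * sp2 N := (act M a u.1, act N a u.2).

Lemma ksum_act_linear M N a : linear (@ksum_act M N a).
Proof. by move=> c u v; rewrite /ksum_act /= !linearP. Qed.

HB.instance Definition _ M N a :=
  GRing.isLinear.Build k _ _ _ (@ksum_act M N a) (@ksum_act_linear M N a).

Definition ksum_lfun M N (a : arrow_space k) :
  'Hom((sp1 M * sp1 N)%type, (sp2 M * sp2 N)%type) := linfun (@ksum_act M N a).

Lemma ksum_lfun_linear M N : linear (@ksum_lfun M N).
Proof.
move=> c a b; apply/lfunP => u.
rewrite add_lfunE scale_lfunE !lfunE /= /ksum_act !linearP /=.
by rewrite !add_lfunE !scale_lfunE.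
Qed.

HB.instance Definition _ M N :=
  GRing.isLinear.Build k _ _ _ (@ksum_lfun M N) (@ksum_lfun_linear M N).

Definition ksum M N : kmod k := KMod (linfun (@ksum_lfun M N)).

Lemma ksumE M N a (u : sp1 M) (v : sp1 N) :
  act (ksum M N) a (u, v) = (act M a u, act N a v).
Proof. by rewrite /= !lfunE. Qed.

Definition indecomposable M : Prop :=
  ~ kzero M /\ forall N N', kiso M (ksum N N') -> kzero N \/ kzero N'.

Definition direct_summand X M : Prop := exists N, kiso M (ksum X N).

Definition finitely_many_classes (P : kmod k -> Prop) : Prop :=
  exists (n : nat) (F : 'I_n -> kmod k),
    forall X, P X -> exists i, kiso X (F i).

Definition preprojective M : Prop :=
  finitely_many_classes (fun X => indecomposable X /\ hom_nonzero X M).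

Definition preinjective M : Prop :=
  finitely_many_classes (fun X => indecomposable X /\ hom_nonzero M X).

Definition regular M : Prop :=
  forall X, indecomposable X -> direct_summand X M ->
    ~ preprojective X /\ ~ preinjective X.

Definition short_exact M' M M'' (f : khom M' M) (g : khom M M'') : Prop :=
  [/\ lker (hom1 f) = 0%VS /\ lker (hom2 f) = 0%VS,
      limg (hom1 f) = lker (hom1 g) /\ limg (hom2 f) = lker (hom2 g)
    & limg (hom1 g) = fullv /\ limg (hom2 g) = fullv].

Definition elementary M : Prop :=
  [/\ ~ kzero M, regular M
    & ~ exists (M' M'' : kmod k) (f : khom M' M) (g : khom M M''),
        [/\ short_exact f g, ~ kzero M', regular M', ~ kzero M''
          & regular M'']].

(* For a basis b of A, [kmx b F] is the module (k^m, k^n) on which the basis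
   element b_i acts by u |-> u *m F i. *)
Definition kmx_lfun (m n : nat) (b : 3.-tuple (arrow_space k))
    (F : 'I_3 -> 'M[k]_(m, n)) (a : arrow_space k) : 'Hom('rV[k]_m, 'rV[k]_n) :=
  \sum_(i < 3) coord b i a *: linfun (mulmxr (F i)).

Lemma kmx_lfun_linear m n b F : linear (@kmx_lfun m n b F).
Proof.
move=> c a a'; rewrite /kmx_lfun scaler_sumr -big_split /=.
by apply: eq_bigr => i _; rewrite linearP /= scalerDl scalerA.
Qed.

HB.instance Definition _ m n b F :=
  GRing.isLinear.Build k _ _ _ (@kmx_lfun m n b F) (@kmx_lfun_linear m n b F).

Definition kmx (m n : nat) (b : 3.-tuple (arrow_space k))
    (F : 'I_3 -> 'M[k]_(m, n)) : kmod k := KMod (linfun (kmx_lfun b F)).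

Lemma kmxE m n (b : 3.-tuple (arrow_space k)) (F : 'I_3 -> 'M[k]_(m, n))
    (i : 'I_3) (u : 'rV[k]_m) :
  basis_of fullv b -> act (kmx b F) b`_i u = u *m F i.
Proof.
move=> /basis_free fb; rewrite /= lfunE /kmx_lfun sum_lfunE (bigD1 i) //=.
rewrite big1 => [|j ji]; rewrite scale_lfunE lfunE /= coord_free //.
  by rewrite eqxx scale1r addr0.
by rewrite eq_sym (negbTE ji) scale0r.
Qed.

(* Rows are indexed by u_1, u_2 and columns by w_1, w_2. *)
Definition X_mx (i : 'I_3) : 'M[k]_(2, 2) :=
  tnth [tuple delta_mx 0 0 + delta_mx 1 1;
              delta_mx 1 0;
              delta_mx 0 1] i.

Definition X_module (alpha beta gamma : arrow_space k) : kmod k :=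
  kmx [tuple alpha; beta; gamma] X_mx.

(* Rows are indexed by u_0, ..., u_3 and columns by w_1, w_2. *)
Definition Y_mx (i : 'I_3) : 'M[k]_(4, 2) :=
  tnth [tuple delta_mx 1 0 + delta_mx 2%:R 1;
              delta_mx 2%:R 0 + delta_mx 3%:R 1;
              delta_mx 0 0 + delta_mx 1 1] i.

Definition Y_module (alpha beta gamma : arrow_space k) : kmod k :=
  kmx [tuple alpha; beta; gamma] Y_mx.

End Modules.

Definition tau (p : int * int) : int * int :=
  (8 * p.1 - 3 * p.2, 3 * p.1 - p.2).

Definition tau_inv (p : int * int) : int * int :=
  (3 * p.2 - p.1, 8 * p.2 - 3 * p.1).

Lemma tauK : cancel tau tau_inv.
Proof. by case=> x y; rewrite /tau /tau_inv /=; congr pair; ring. Qed.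

Lemma tau_invK : cancel tau_inv tau.
Proof. by case=> x y; rewrite /tau /tau_inv /=; congr pair; ring. Qed.

Definition tau_pow (t : int) (p : int * int) : int * int :=
  match t with
  | Posz n => iter n tau p
  | Negz n => iter n.+1 tau_inv p
  end.

Definition tau_orbit (q p : int * int) : Prop := exists t : int, p = tau_pow t q.

(* Main.v *)
From HB Require Import structures.
Require Import Defs.
From mathcomp Require Import all_boot all_order all_algebra.
From mathcomp Require Import ring lra zify.
From mathcomp.real_closed Require Import realalg.
From Stdlib Require Import Classical.

(** The key is a numerical description of regularity. With c = (3 - sqrt 5) / 2
and the linear forms L1 (x, y) = y - c x and L2 (x, y) = (3 - c) x - y, a module
is regular if and only if L1 is positive on all its nonzero submodules and L2 on
all its nonzero factor modules; it is elementary if and only if, moreover, no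
submodule U satisfies L2 (U) > 0 and L1 (M / U) > 0. These conditions are
invariant under duality (x, y) -> (y, x) and under the reflection
(x, y) -> (x, 3x - y), which sends M_2 = (A (x) M_1) / K to the annihilator of K
in (A (x) M_1)^*. Hence it suffices to consider dimension vectors with
2x/3 <= y <= x. There an element u of M_1 with dim Au <= 2 generates a submodule
U violating the last condition, unless (x, y) is (1, 1) or (2, 2). Such a u comes
from a singular member of a pencil of square matrices, except for (4, 3), whose
dual (3, 4) needs a zero divisor of a bilinear map k^3 x k^3 -> k^4; it comes from
a root of a binary form of degree 6. *)

Set Implicit Arguments.
Unset Strict Implicit.
Unset Printing Implicit Defensive.

Import Order.TTheory GRing.Theory Num.Theory.
Import VectorInternalTheory.
Local Open Scope ring_scope.

(** * Slopes of dimension vectors *)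

(** The number c is the smaller root of t^2 - 3t + 1, and L1 and L2 are eigenforms of duality
    followed by reflection, (x, y) -> (y, 3y - x), with eigenvalues 3 - c and c. Preprojective and
    preinjective modules are defined by finiteness of a set of isomorphism classes, so no list of
    indecomposable modules is at hand. Two arguments connect the definition with numbers. A module
    with a submodule where L1 <= 0 has an indecomposable summand with the same defect; duality
    followed by reflection lowers the first dimension of that submodule until the simple injective
    module is reached, and finiteness is carried back along these steps. Conversely, if L2 is
    positive on the module, the Euler form yields nonzero maps from preprojective modules of
    unbounded dimension; the other side is dual. A submodule U with L2 (U) > 0 and L1 (M / U) > 0
    need not be regular, nor its factor module. Two extremal choices replace it by one that is,
    because L1 and L2 are additive and, c being irrational, vanish on no nonzero dimension
    vector. *)

Lemma golden_root : {c : realalg | 3 / 8 < c < 2 / 5 & c * (3 - c) = 1}.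
Proof.
have s0 : 0 <= Num.sqrt 5 :> realalg by rewrite sqrtr_ge0.
have s2 : Num.sqrt 5 * Num.sqrt 5 = 5 :> realalg.
  by rewrite -expr2 sqr_sqrtr.
exists ((3 - Num.sqrt 5) / 2); last by lra.
by apply/andP; split; nra.
Qed.

Definition slope : realalg := s2val golden_root.

Lemma slope_bounds : 3 / 8 < slope < 2 / 5.
Proof. exact: s2valP golden_root. Qed.

Lemma slope_eq : slope * (3 - slope) = 1.
Proof. exact: s2valP' golden_root. Qed.

(* L1 and L2 are positive exactly above, resp. below, the cones spanned by the
   preinjective, resp. preprojective, dimension vectors. *)
Definition L1 (x y : nat) : realalg := y%:R - slope * x%:R.
Definition L2 (x y : nat) : realalg := (3 - slope) * x%:R - y%:R.

(** Infinite descent at the prime 3: -1 is not a square modulo 3, so both variables are divisible by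
    3. This takes the place of the irrationality of [slope]. *)
Lemma kronecker_form_isotropic (x y : nat) :
  (x * x + y * y = 3 * (x * y))%N -> x = 0%N /\ y = 0%N.
Proof.
move: {2}(x + y)%N (leqnn (x + y)) => n; elim: n x y => [|n IHn] x y le_n e.
  by lia.
have [x0|x0] := posnP x; first by move: e; rewrite x0; nia.
have dv (a b : nat) : (a * a + b * b = 3 * (a * b))%N -> (3 %| a)%N.
  have := divn_eq a 3; have := divn_eq b 3.
  have := ltn_pmod a (isT : (0 < 3)%N); have := ltn_pmod b (isT : (0 < 3)%N).
  rewrite /dvdn.
  move: (a %/ 3)%N (b %/ 3)%N (a %% 3)%N (b %% 3)%N => qa qb ra rb rb3 ra3 -> ->.
  case: ra ra3 => [//|[|[|//]]] _; case: rb rb3 => [|[|[|//]]] _; lia.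
have /dvdnP[x' ex] := dv _ _ e.
have /dvdnP[y' ey] : (3 %| y)%N by apply: (dv y x); lia.
have [] := IHn x' y'; [lia| |lia].
by move: e; rewrite ex ey; nia.
Qed.

(** [L1 x y * L2 x y] is 3xy - x^2 - y^2, so a zero of either factor is isotropic. *)
Lemma L1_eq0 (x y : nat) : L1 x y = 0 -> x = 0%N /\ y = 0%N.
Proof.
move=> e; apply: kronecker_form_isotropic; apply/eqP.
rewrite -(eqr_nat realalg) !natrD !natrM.
by move: e slope_eq; rewrite /L1 => e s; apply/eqP; nra.
Qed.

Lemma L2_eq0 (x y : nat) : L2 x y = 0 -> x = 0%N /\ y = 0%N.
Proof.
move=> e; apply: kronecker_form_isotropic; apply/eqP.
rewrite -(eqr_nat realalg) !natrD !natrM.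
by move: e slope_eq; rewrite /L2 => e s; apply/eqP; nra.
Qed.

(** A submodule of dimension vector (1, b) with b <= 2 has L1 at most 2 - c. Modules of dimension
    vectors (2, 3), (3, 3) and (3, 4) exceed this value, so it makes them [splitting]; in dimension
    (2, 2) the bound 1 - c excludes b <= 1. *)
Lemma L1_23 : 2 - slope < L1 2 3.
Proof. by have := slope_bounds; rewrite /L1; lra. Qed.

Lemma L1_33 : 2 - slope < L1 3 3.
Proof. by have := slope_bounds; rewrite /L1; lra. Qed.

Lemma L1_34 : 2 - slope < L1 3 4.
Proof. by have := slope_bounds; rewrite /L1; lra. Qed.

Lemma L1_22 : 1 - slope < L1 2 2.
Proof. by have := slope_bounds; rewrite /L1; lra. Qed.

(** * Representations and reflections *)

Section Rep.
Variable k : fieldType.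

Definition rep m n := 'I_3 -> 'M[k]_(m, n).

Definition rhom m n m' n' (F : rep m n) (F' : rep m' n')
    (f1 : 'M_(m, m')) (f2 : 'M_(n, n')) : Prop :=
  forall i, F i *m f2 = f1 *m F' i.

(** Inverses are explicit because the dimensions are only proved equal afterwards, in [riso_dim]. *)
Definition riso m n m' n' (F : rep m n) (F' : rep m' n') : Prop :=
  exists f1 f2 g1 g2, [/\ rhom F F' f1 f2,
    f1 *m g1 = 1%:M, g1 *m f1 = 1%:M, f2 *m g2 = 1%:M & g2 *m f2 = 1%:M].

Definition rsum m n m' n' (F : rep m n) (F' : rep m' n')
  : rep (m + m') (n + n') := fun i => block_mx (F i) 0 0 (F' i).

Definition rindec m n (F : rep m n) : Prop := (0 < m + n)%N /\
  forall m1 n1 m2 n2 (G : rep m1 n1) (H : rep m2 n2),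
    riso F (rsum G H) -> (m1 + n1 = 0)%N \/ (m2 + n2 = 0)%N.

Definition dual m n (F : rep m n) : rep n m := fun i => (F i)^T.

Definition stack m n (F : rep m n) := \mxcol_(i < 3) F i.

Definition gen_full m n (F : rep m n) := \rank (stack F) = n.

(* The column spaces of [stack F] and [stack G] are each other's annihilators in
   the dual of A (x) M_1 and in A (x) M_1: G is the dual of the reflection of F. *)
Definition refl_pair m n p (F : rep m n) (G : rep m p) : Prop :=
  [/\ \sum_i (F i)^T *m G i = 0, gen_full F, gen_full G & (n + p = 3 * m)%N].

(** The rows of the left kernel are the relations K in A (x) M_1; the three blocks of the transposed
    basis matrix are the maps from M_1^* to K^*. *)
Definition reflection m n (F : rep m n) : rep m (\rank (kermx (stack F))) :=
  fun i => submxcol (row_base (kermx (stack F)))^T i.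

Lemma rhom_dual m n m' n' (F : rep m n) (F' : rep m' n') f1 f2 :
  rhom F F' f1 f2 -> rhom (dual F') (dual F) f2^T f1^T.
Proof. by move=> h i; rewrite /dual -!trmx_mul h. Qed.

Lemma riso_refl m n (F : rep m n) : riso F F.
Proof.
exists 1%:M, 1%:M, 1%:M, 1%:M; split; rewrite ?mulmx1 //.
by move=> i; rewrite mulmx1 mul1mx.
Qed.

Lemma riso_eq m n (F F' : rep m n) : F =1 F' -> riso F F'.
Proof.
move=> e; exists 1%:M, 1%:M, 1%:M, 1%:M; split; rewrite ?mulmx1 //.
by move=> i; rewrite mulmx1 mul1mx.
Qed.

Lemma riso_sym m n m' n' (F : rep m n) (F' : rep m' n') :
  riso F F' -> riso F' F.
Proof.
case=> f1 [f2] [g1] [g2] [h a b c d]; exists g1, g2, f1, f2; split=> // i.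
by rewrite -[F' i]mul1mx -b -(mulmxA g1) -h -!mulmxA c mulmx1.
Qed.

Lemma riso_trans m n m' n' m'' n'' (F : rep m n) (F' : rep m' n')
    (F'' : rep m'' n'') : riso F F' -> riso F' F'' -> riso F F''.
Proof.
case=> f1 [f2] [g1] [g2] [h a b c d] [f1'] [f2'] [g1'] [g2'] [h' a' b' c' d'].
exists (f1 *m f1'), (f2 *m f2'), (g1' *m g1), (g2' *m g2); split.
- by move=> i; rewrite mulmxA h -!mulmxA h'.
- by rewrite mulmxA -(mulmxA f1) a' mulmx1.
- by rewrite mulmxA -(mulmxA g1') b mulmx1.
- by rewrite mulmxA -(mulmxA f2) c' mulmx1.
- by rewrite mulmxA -(mulmxA g2') d mulmx1.
Qed.

Lemma bij_mx_dim m n (A : 'M[k]_(m, n)) (B : 'M_(n, m)) :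
  A *m B = 1%:M -> B *m A = 1%:M -> m = n.
Proof.
move=> ab ba; apply/eqP; rewrite eqn_leq.
have := mxrankM_maxl A B; have := mxrankM_maxl B A; rewrite ab ba !mxrank1.
by move=> nr mr; rewrite (leq_trans mr (rank_leq_col _)) (leq_trans nr (rank_leq_col _)).
Qed.

Lemma riso_dim m n m' n' (F : rep m n) (F' : rep m' n') :
  riso F F' -> m = m' /\ n = n'.
Proof.
by case=> f1 [f2] [g1] [g2] [_ a b c d]; split; [exact: bij_mx_dim a b | exact: bij_mx_dim c d].
Qed.

Lemma riso_dual m n m' n' (F : rep m n) (F' : rep m' n') :
  riso F F' -> riso (dual F) (dual F').
Proof.
move/riso_sym; case=> f1 [f2] [g1] [g2] [h a b c d].
exists f2^T, f1^T, g2^T, g1^T; split; first exact: rhom_dual.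
all: by rewrite -trmx_mul ?a ?b ?c ?d trmx1.
Qed.

Lemma dual_rsum m n m' n' (F : rep m n) (F' : rep m' n') :
  dual (rsum F F') =1 rsum (dual F) (dual F').
Proof. by move=> i; rewrite /dual /rsum tr_block_mx !trmx0. Qed.

Lemma dualK m n (F : rep m n) : dual (dual F) =1 F.
Proof. by move=> i; rewrite /dual trmxK. Qed.

Lemma rindec_riso m n m' n' (F : rep m n) (F' : rep m' n') :
  riso F F' -> rindec F -> rindec F'.
Proof.
move=> e [nz h]; have [em en] := riso_dim e.
split=> [|m1 n1 m2 n2 G H e']; first by rewrite -em -en.
exact: (h _ _ _ _ G H (riso_trans e e')).
Qed.

Lemma rindec_dual m n (F : rep m n) : rindec F -> rindec (dual F).
Proof.
case=> nz h; split; first by rewrite addnC.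
move=> m1 n1 m2 n2 G H /riso_dual e.
rewrite addnC (addnC m2); apply: (h _ _ _ _ (dual G) (dual H)).
apply: riso_trans (riso_trans e (riso_eq (dual_rsum _ _))).
exact/riso_sym/riso_eq/dualK.
Qed.

Lemma stack_mul m n (F : rep m n) p (A : 'M_(n, p)) :
  stack F *m A = stack (fun i => F i *m A).
Proof. by rewrite /stack mxcol_mul. Qed.

Lemma dim3 m : (\sum_(i < 3) m = 3 * m)%N.
Proof. by rewrite sum_nat_const card_ord. Qed.

Lemma tr_stack_mul m n p (F : rep m n) (G : rep m p) :
  (stack F)^T *m stack G = \sum_i (F i)^T *m G i.
Proof. by rewrite tr_mxcol mul_mxrow_mxcol. Qed.

Lemma stack_submxcol m n (A : 'M_(\sum_(i < 3) m, n)) :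
  stack (submxcol A) = A.
Proof. exact: submxcolK. Qed.

Lemma stack_inj m n (F G : rep m n) : stack F = stack G -> F =1 G.
Proof. by move=> e i; rewrite -[F i](mxcolK F) -/(stack F) e mxcolK. Qed.

Lemma eq_stack m n (F G : rep m n) : F =1 G -> stack F = stack G.
Proof. by move=> e; apply/eq_mxcol. Qed.

Lemma stack_subP m n (F : rep m n) p (A : 'M_(p, n)) :
  reflect (forall i, F i <= A)%MS (stack F <= A)%MS.
Proof.
rewrite /stack eqmx_col; apply: (iffP sumsmx_subP) => h i.
  by have := h i isT; rewrite genmxE.
by move=> _; rewrite genmxE.
Qed.

Lemma arr_sub_stack m n (F : rep m n) i : (F i <= stack F)%MS.
Proof. exact: (stack_subP F (stack F) (submx_refl _)). Qed.

Lemma refl_pair_refl m n (F : rep m n) : gen_full F -> refl_pair F (reflection F).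
Proof.
move=> gF; have e : stack (reflection F) = (row_base (kermx (stack F)))^T.
  exact: stack_submxcol.
have rk : \rank (kermx (stack F)) = (3 * m - n)%N.
  by rewrite mxrank_ker gF; congr subn; apply: dim3.
split=> //.
- rewrite -tr_stack_mul e; apply: (can_inj trmxK); rewrite trmx_mul !trmxK trmx0.
  by apply/sub_kermxP; rewrite eq_row_base.
- by rewrite /gen_full e mxrank_tr; apply/eqP/row_base_free.
- rewrite rk subnKC // -[X in (X <= _)%N]gF -[X in (_ <= X)%N](dim3 m); exact: rank_leq_row.
Qed.

Lemma refl_pair_sym m n p (F : rep m n) (G : rep m p) : refl_pair F G -> refl_pair G F.
Proof.
case=> e a b c; split=> //; last by rewrite addnC.
by rewrite -tr_stack_mul; apply: (can_inj trmxK); rewrite trmx_mul trmxK tr_stack_mul e trmx0.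
Qed.

Lemma refl_pair_eqr m n p (F : rep m n) (G G' : rep m p) :
  G =1 G' -> refl_pair F G -> refl_pair F G'.
Proof.
move=> eG [e gF gG d]; split=> //; last by rewrite /gen_full -(eq_stack eG).
by rewrite -[RHS]e; apply: eq_bigr => i _; rewrite eG.
Qed.

Lemma refl_pair_ker m n p (F : rep m n) (G : rep m p) :
  refl_pair F G -> ((stack G)^T == kermx (stack F))%MS.
Proof.
move=> /[dup] /refl_pair_sym [e _ _ _] [_ gF gG d].
have s : ((stack G)^T <= kermx (stack F))%MS.
  by apply/sub_kermxP; rewrite tr_stack_mul.
rewrite -mxrank_leqif_eq // mxrank_ker mxrank_tr gF gG; apply/eqP.
transitivity (3 * m - n)%N; first lia.
by congr subn; rewrite dim3.
Qed.

(** A morphism carries relations of F to relations of F'; transposing the induced map of relation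
    spaces gives [g2]. Hence the direction is reversed. *)
Lemma refl_pair_hom m n p m' n' p' (F : rep m n) (G : rep m p)
    (F' : rep m' n') (G' : rep m' p') f1 f2 :
  refl_pair F G -> refl_pair F' G' -> rhom F F' f1 f2 ->
  exists g2, rhom G' G f1^T g2.
Proof.
move=> cFG cFG' h.
have /submxP[g e] : ((stack (fun i => f1^T *m G i))^T <= (stack G')^T)%MS.
  rewrite (eqmxP (refl_pair_ker cFG')); apply/sub_kermxP; rewrite tr_stack_mul.
  have [_ _ _ _] := cFG; have [eG _ _ _] := refl_pair_sym cFG.
  rewrite -[RHS](mul0mx _ f2) -eG mulmx_suml; apply: eq_bigr => i _.
  by rewrite trmx_mul trmxK -!mulmxA h.
exists g^T => i.
move/(congr1 trmx): e; rewrite trmxK trmx_mul trmxK stack_mul => /stack_inj e.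
by rewrite e.
Qed.

(** Uniqueness principle: when M_1 generates M_2, the second component of a morphism is determined
    by the first. *)
Lemma stack_mul0 m n p (F : rep m n) (A : 'M_(n, p)) : gen_full F ->
  (forall i, F i *m A = 0) -> A = 0.
Proof.
move=> gF e; have ful : row_full (stack F) by rewrite /row_full gF.
have e0 : stack F *m A = 0.
  rewrite stack_mul; apply/eqP; rewrite -submx0; apply/stack_subP => i.
  by rewrite e sub0mx.
by rewrite -[A]mul1mx -(mulVpmx ful) -mulmxA e0 mulmx0.
Qed.

Lemma refl_pair_riso m n p m' n' p' (F : rep m n) (G : rep m p)
    (F' : rep m' n') (G' : rep m' p') :
  refl_pair F G -> refl_pair F' G' -> riso F F' -> riso G G'.
Proof.
move=> cF cF' [f1] [f2] [g1] [g2] [h a b c d].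
have hg : rhom F' F g1 g2.
  by move=> i; rewrite -[F' i]mul1mx -b -(mulmxA g1) -h -!mulmxA c mulmx1.
have [u2 hu] := refl_pair_hom cF cF' h; have [v2 hv] := refl_pair_hom cF' cF hg.
have [_ _ gG _] := cF; have [_ _ gG' _] := cF'.
exists g1^T, v2, f1^T, u2; split=> //; rewrite -?trmx_mul ?a ?b ?trmx1 //.
- apply/eqP; rewrite -subr_eq0; apply/eqP; apply: (stack_mul0 gG) => i.
  rewrite mulmxBr mulmx1 mulmxA hv -mulmxA hu mulmxA -trmx_mul a trmx1 mul1mx.
  by rewrite subrr.
- apply/eqP; rewrite -subr_eq0; apply/eqP; apply: (stack_mul0 gG') => i.
  rewrite mulmxBr mulmx1 mulmxA hu -mulmxA hv mulmxA -trmx_mul b trmx1 mul1mx.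
  by rewrite subrr.
Qed.

Lemma refl_pair_rsum m n p m' n' p' (F : rep m n) (G : rep m p)
    (F' : rep m' n') (G' : rep m' p') :
  refl_pair F G -> refl_pair F' G' -> refl_pair (rsum F F') (rsum G G').
Proof.
have full_sum a b a' b' (H : rep a b) (H' : rep a' b') :
    gen_full H -> gen_full H' -> gen_full (rsum H H').
  move=> gH gH'; apply/eqP; rewrite -[_ == _]/(row_full _) -sub1mx.
  have [f f'] : row_full (stack H) /\ row_full (stack H').
    by rewrite /row_full gH gH'.
  have inH : (stack (fun i => row_mx (H i) (0 : 'M_(_, b'))) <= stack (rsum H H'))%MS.
    apply/stack_subP => i; apply: submx_trans (arr_sub_stack _ i); apply/submxP.
    by exists (row_mx 1%:M 0); rewrite mul_row_block !mul0mx !mul1mx !addr0.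
  have inH' : (stack (fun i => row_mx (0 : 'M_(_, b)) (H' i)) <= stack (rsum H H'))%MS.
    apply/stack_subP => i; apply: submx_trans (arr_sub_stack _ i); apply/submxP.
    by exists (row_mx 0 1%:M); rewrite mul_row_block !mul0mx !mul1mx !add0r.
  rewrite scalar_mx_block col_mx_sub; apply/andP; split.
    apply: submx_trans inH.
    rewrite (_ : stack _ = stack H *m row_mx 1%:M 0).
      by rewrite -[X in (X <= _)%MS]mul1mx -(mulVpmx f) -mulmxA submxMl.
    by rewrite stack_mul; apply: eq_stack => i; rewrite mul_mx_row mulmx1 mulmx0.
  apply: submx_trans inH'.
  rewrite (_ : stack _ = stack H' *m row_mx 0 1%:M).
    by rewrite -[X in (X <= _)%MS]mul1mx -(mulVpmx f') -mulmxA submxMl.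
  by rewrite stack_mul; apply: eq_stack => i; rewrite mul_mx_row mulmx1 mulmx0.
case=> e a b c [e' a' b' c']; split; [|exact: full_sum|exact: full_sum|lia].
have eb i : (rsum F F' i)^T *m rsum G G' i
   = block_mx ((F i)^T *m G i) 0 0 ((F' i)^T *m G' i).
  by rewrite /rsum tr_block_mx !trmx0 mulmx_block !mulmx0 !mul0mx !addr0 !add0r.
rewrite (eq_bigr _ (fun i _ => eb i)).
rewrite !big_ord_recl !big_ord0 !addr0 !add_block_mx !addr0.
by move: e e'; rewrite !big_ord_recl !big_ord0 !addr0 => -> ->; rewrite block_mx0.
Qed.

End Rep.

(** * Subrepresentations *)

Section Sub.
Variable k : fieldType.
Local Notation rep := (rep k).

Definition subrep m n (F : rep m n) p q (U1 : 'M_(p, m)) (U2 : 'M_(q, n)) :=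
  forall i, (U1 *m F i <= U2)%MS.

Definition has_sub m n (F : rep m n) (a b : nat) := exists p q (U1 : 'M_(p, m))
  (U2 : 'M_(q, n)), [/\ subrep F U1 U2, \rank U1 = a & \rank U2 = b].

(* [above_preinj F] and [below_preproj F] say that F has no preinjective,
   resp. preprojective, direct summand. *)
Definition above_preinj m n (F : rep m n) :=
  forall a b, has_sub F a b -> (0 < a + b)%N -> 0 < L1 a b.

Definition below_preproj m n (F : rep m n) :=
  forall a b, has_sub F a b -> (a + b < m + n)%N -> 0 < L2 m n - L2 a b.

(** The difference is L1 of the factor module. Neither the submodule nor the factor is required to
    be regular; [splitting_exact] passes to regular ones. *)
Definition splitting m n (F : rep m n) :=
  exists a b, [/\ has_sub F a b, 0 < L2 a b & 0 < L1 m n - L1 a b].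

Definition relem m n (F : rep m n) :=
  [/\ (0 < m + n)%N, above_preinj F, below_preproj F & ~ splitting F].

Lemma has_sub_leq m n (F : rep m n) a b :
  has_sub F a b -> (a <= m)%N /\ (b <= n)%N.
Proof. by case=> p [q] [U1] [U2] [_ <- <-]; rewrite !rank_leq_col. Qed.

Lemma has_sub_riso m n m' n' (F : rep m n) (F' : rep m' n') a b :
  riso F F' -> has_sub F a b -> has_sub F' a b.
Proof.
case=> f1 [f2] [g1] [g2] [h ab _ cd _] [p] [q] [U1] [U2] [s <- <-].
exists p, q, (U1 *m f1), (U2 *m f2).
have r1 : row_free f1 by apply/row_freeP; exists g1.
have r2 : row_free f2 by apply/row_freeP; exists g2.
split; rewrite ?mxrankMfree // => i.
by rewrite -mulmxA -h mulmxA submxMr.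
Qed.

Lemma relem_riso m n m' n' (F : rep m n) (F' : rep m' n') :
  riso F F' -> relem F -> relem F'.
Proof.
move=> e [nz fi tp ns]; have [em en] := riso_dim e.
have s a b : has_sub F' a b -> has_sub F a b.
  by apply: has_sub_riso; apply: riso_sym.
subst m' n'; split=> // [a b /s|a b /s|[a] [b] [/s h u v]].
- exact: fi.
- exact: tp.
- by apply: ns; exists a, b.
Qed.

Definition perp p m (U : 'M[k]_(p, m)) := kermx U^T.

Lemma rank_perp p m (U : 'M[k]_(p, m)) : \rank (perp U) = (m - \rank U)%N.
Proof. by rewrite mxrank_ker mxrank_tr. Qed.

Lemma sub_perp p q m (U : 'M[k]_(p, m)) (W : 'M_(q, m)) :
  (W <= perp U)%MS = (W *m U^T == 0).
Proof. exact: sub_kermx. Qed.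

Lemma sub_perp_sym p q m (U : 'M[k]_(p, m)) (W : 'M_(q, m)) :
  (W <= perp U)%MS = (U <= perp W)%MS.
Proof. by rewrite !sub_perp -trmx_eq0 trmx_mul trmxK. Qed.

Lemma perp_perp p m (U : 'M[k]_(p, m)) : (perp (perp U) == U)%MS.
Proof.
rewrite andbC -mxrank_leqif_eq; last by rewrite sub_perp_sym.
by rewrite !rank_perp subKn // rank_leq_col.
Qed.

Lemma perpS p q m (U : 'M[k]_(p, m)) (W : 'M_(q, m)) :
  (U <= W)%MS -> (perp W <= perp U)%MS.
Proof. by move=> s; rewrite sub_perp_sym (submx_trans s) // sub_perp_sym. Qed.

Lemma sub_dual m n (F : rep m n) p q (U1 : 'M_(p, m)) (U2 : 'M_(q, n)) :
  subrep F U1 U2 -> subrep (dual F) (perp U2) (perp U1).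
Proof.
move=> s i; rewrite sub_perp -mulmxA -trmx_mul -sub_perp.
exact: perpS.
Qed.

Lemma has_sub_dual m n (F : rep m n) a b :
  has_sub F a b -> has_sub (dual F) (n - b) (m - a).
Proof.
case=> p [q] [U1] [U2] [s <- <-].
by exists n, m, (perp U2), (perp U1); split; rewrite ?rank_perp //; apply: sub_dual.
Qed.

Lemma has_sub_dualE m n (F : rep m n) a b :
  has_sub (dual F) a b -> has_sub F (m - b) (n - a).
Proof.
move/has_sub_dual; apply: has_sub_riso; apply/riso_eq/dualK.
Qed.

Lemma L1_sub m n a b : (a <= m)%N -> (b <= n)%N ->
  L1 (m - a) (n - b) = L1 m n - L1 a b.
Proof. by move=> am bn; rewrite /L1 !natrB //; ring. Qed.

Lemma L2_sub m n a b : (a <= m)%N -> (b <= n)%N ->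
  L2 (m - a) (n - b) = L2 m n - L2 a b.
Proof. by move=> am bn; rewrite /L2 !natrB //; ring. Qed.

Lemma L1_swap a b : L1 a b = slope * L2 b a.
Proof. by rewrite /L1 /L2 mulrBr mulrA slope_eq mul1r. Qed.

Lemma L2_swap a b : L2 a b = (3 - slope) * L1 b a.
Proof. by rewrite /L1 /L2 mulrBr mulrA [_ * slope]mulrC slope_eq mul1r. Qed.

Lemma slope_gt0 : 0 < slope.
Proof. by have := slope_bounds; lra. Qed.

Lemma coslope_gt0 : 0 < 3 - slope.
Proof. by have := slope_bounds; lra. Qed.

Lemma L1_swap_gt0 a b : (0 < L1 a b) = (0 < L2 b a).
Proof. by rewrite L1_swap pmulr_rgt0 // slope_gt0. Qed.

Lemma L2_swap_gt0 a b : (0 < L2 a b) = (0 < L1 b a).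
Proof. by rewrite L2_swap pmulr_rgt0 // coslope_gt0. Qed.

Lemma above_preinj_dual m n (F : rep m n) :
  below_preproj F -> above_preinj (dual F).
Proof.
move=> tp a b /[dup] /has_sub_leq [an bm] /has_sub_dualE h nz.
rewrite L1_swap_gt0 -[a](subKn an) -[b](subKn bm) L2_sub ?leq_subr //.
by apply: tp h _; lia.
Qed.

Lemma below_preproj_dual m n (F : rep m n) :
  above_preinj F -> below_preproj (dual F).
Proof.
move=> fi a b /[dup] /has_sub_leq [an bm] /has_sub_dualE h nz.
by rewrite -L2_sub // L2_swap_gt0; apply: fi h _; lia.
Qed.

Lemma splitting_dual m n (F : rep m n) : splitting (dual F) -> splitting F.
Proof.
case=> a [b] [/[dup] /has_sub_leq [an bm] /has_sub_dualE h u v].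
exists (m - b)%N, (n - a)%N; split=> //.
  by rewrite L2_swap_gt0 L1_sub.
by rewrite -L1_sub ?leq_subr // !subKn // L1_swap_gt0.
Qed.

Lemma relem_dual m n (F : rep m n) : relem F -> relem (dual F).
Proof.
case=> nz fi tp ns; split; first by rewrite addnC.
- exact: above_preinj_dual.
- exact: below_preproj_dual.
- by move/splitting_dual.
Qed.

(** The factor module F / U has dimension vector (m - a, n - b), and the dual of M_1 / U_1 generates
    a submodule of G. Each functional on M_2 / U_2 gives a relation between these generators, which
    bounds b' by 3(m - a) - (n - b). *)
Lemma has_sub_refl_pair m n p (F : rep m n) (G : rep m p) a b :
  refl_pair F G -> has_sub F a b ->
  exists2 b', has_sub G (m - a) b' & (b' + n <= 3 * (m - a) + b)%N.
Proof.
case=> e gF gG d [q1] [q2] [U1] [U2] [s <- <-].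
pose V := row_base (perp U1); pose V2 := stack (fun i => V *m G i).
exists (\rank V2).
  exists _, _, V, V2; split=> //; last by rewrite /V eq_row_base rank_perp.
  by move=> i; apply: (arr_sub_stack (fun i => V *m G i)).
pose Y := perp U2; pose W i := Y *m (F i)^T *m pinvmx V.
have WV i : W i *m V = Y *m (F i)^T.
  by rewrite /W mulmxKpV // eq_row_base; apply: (sub_dual s).
pose WW := \mxrow_(i < 3) W i.
have kW : (WW <= kermx V2)%MS.
  apply/sub_kermxP; rewrite /WW /V2 /stack mul_mxrow_mxcol.
  under eq_bigr => i _ do rewrite mulmxA WV -mulmxA.
  by rewrite -mulmx_sumr e mulmx0.
(* Independent functionals give independent relations, since a functional on M_2 that vanishes on
   all F_i is zero. *)
have kY : (kermx WW <= kermx Y)%MS.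
  apply/sub_kermxP; apply: trmx_inj; rewrite trmx0.
  apply: (stack_mul0 gF) => i.
  apply: trmx_inj; rewrite trmx_mul trmxK trmx0 -mulmxA -WV mulmxA.
  suff -> : kermx WW *m W i = 0 by rewrite mul0mx.
  by rewrite -[W i](mxrowK W) -/WW mul_submxrow mulmx_ker submxrow0.
have := mxrankS kW; have := mxrankS kY; rewrite !mxrank_ker.
have := rank_perp U2; rewrite -/Y.
have := rank_leq_row Y; have := rank_leq_row WW; have := rank_leq_col U2.
have := rank_leq_row V2.
have eS : (\sum_(i < 3) \rank (perp U1) = 3 * (m - \rank U1))%N.
  by rewrite dim3 rank_perp.
move: (\rank V2) (\rank Y) (\rank WW) => v y w; rewrite eS; lia.
Qed.

(** Otherwise factoring out the submodule generated by M_1 leaves a nonzero factor module of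
    dimension vector (0, d), where L2 is negative. *)
Lemma below_preproj_full m n (F : rep m n) : below_preproj F -> gen_full F.
Proof.
move=> tp; apply/eqP; rewrite eqn_leq rank_leq_col leqNgt; apply/negP => lt.
have h : has_sub F m (\rank (stack F)).
  exists m, _, 1%:M, (stack F); split; rewrite ?mxrank1 // => i.
  by rewrite mul1mx arr_sub_stack.
have := tp _ _ h; rewrite ltn_add2l lt /L2 => /(_ isT).
by move: lt; rewrite -(ltr_nat realalg); lra.
Qed.

(** For a submodule (a, b) of G, the matching factor module of F has dimension vector (a, n - b'),
    and the bound on b' says that its L2 is at most [L1 a b]. The case a = 0 is separate because
    that factor module may vanish. *)
Lemma above_preinj_refl_pair m n p (F : rep m n) (G : rep m p) :
  refl_pair F G -> below_preproj F -> above_preinj G.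
Proof.
move=> c tp a b /[dup] /has_sub_leq [am bp] /(has_sub_refl_pair (refl_pair_sym c)).
case=> b' /[dup] /has_sub_leq [_ b'n] h le nz; have [_ _ _ d] := c.
have [a0|a0] := posnP a.
  by move: nz; rewrite a0 add0n -(ltr_nat realalg) /L1; lra.
have lt : (m - a + b' < m + n)%N by lia.
have := tp _ _ h lt; rewrite /L2 /L1 natrB //.
have : (b' + 3 * a <= n + b)%N by lia.
by rewrite -(ler_nat realalg) !natrD; lra.
Qed.

Lemma below_preproj_refl_pair m n p (F : rep m n) (G : rep m p) :
  refl_pair F G -> above_preinj F -> below_preproj G.
Proof.
move=> c fi a b /[dup] /has_sub_leq [am bp] /(has_sub_refl_pair (refl_pair_sym c)).
case=> b' /[dup] /has_sub_leq [_ b'n] h le nz; have [_ _ _ d] := c.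
have lt : (0 < m - a + b')%N by lia.
have := fi _ _ h lt; rewrite /L2 /L1 natrB //.
have : (b' + p + 3 * a <= 3 * m + b)%N by lia.
by rewrite -(ler_nat realalg) !natrD; lra.
Qed.

Lemma splitting_refl_pair m n p (F : rep m n) (G : rep m p) :
  refl_pair F G -> splitting G -> splitting F.
Proof.
move=> c [a] [b] [/[dup] /has_sub_leq [am bp] /(has_sub_refl_pair (refl_pair_sym c))].
case=> b' h le u v; have [_ _ _ d] := c.
exists (m - a)%N, b'; split=> //; move: u v; rewrite /L1 /L2 natrB //.
  have : (b' + p + 3 * a <= 3 * m + b)%N by lia.
  by rewrite -(ler_nat realalg) !natrD; lra.
have : (b' + 3 * a <= n + b)%N by lia.
by rewrite -(ler_nat realalg) !natrD; lra.
Qed.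

Lemma relem_refl_pair m n p (F : rep m n) (G : rep m p) :
  refl_pair F G -> relem F -> relem G.
Proof.
move=> c [nz fi tp ns]; have [_ _ _ d] := c; split; first by lia.
- exact: above_preinj_refl_pair c tp.
- exact: below_preproj_refl_pair c fi.
- by move/(splitting_refl_pair c).
Qed.

End Sub.

(** * Finiteness up to isomorphism *)

Section Fin.
Variable k : fieldType.
Local Notation rep := (rep k).

Lemma rsum_iso m n m1 n1 m2 n2 (F : rep m n) (G : rep m1 n1) (H : rep m2 n2)
    g1 g2 h1 h2 : rhom G F g1 g2 -> rhom H F h1 h2 ->
  row_free (col_mx g1 h1) -> row_full (col_mx g1 h1) ->
  row_free (col_mx g2 h2) -> row_full (col_mx g2 h2) -> riso F (rsum G H).
Proof.
move=> hg hh fr1 fu1 fr2 fu2; apply: riso_sym.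
exists (col_mx g1 h1), (col_mx g2 h2), (pinvmx (col_mx g1 h1)),
  (pinvmx (col_mx g2 h2)); split; rewrite ?mulVpmx ?mulmxVp //.
by move=> i; rewrite /rsum mul_block_col !mul0mx addr0 add0r hg hh mul_col_mx.
Qed.

(** A complement in M_2 of the span of the images splits off as a direct summand of dimension vector
    (0, d). *)
Lemma rindec_full m n (F : rep m n) : rindec F -> (0 < m)%N -> gen_full F.
Proof.
case=> _ h m0; apply/eqP; rewrite eqn_leq rank_leq_col leqNgt; apply/negP => lt.
pose B := row_base (stack F); pose C := row_base (stack F)^C%MS.
pose G : rep _ _ := fun i => F i *m pinvmx B.
pose H : rep 0 (\rank (stack F)^C%MS) := fun i => 0.
have FB i : G i *m B = F i.
  by rewrite /G mulmxKpV // eq_row_base; apply: arr_sub_stack.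
have full2 : row_full (col_mx B C).
  rewrite -sub1mx -addsmxE (eqmxP (_ : B + C == stack F + (stack F)^C)%MS).
    by rewrite sub1mx addsmx_compl_full.
  by apply/eqmxP; apply: adds_eqmx; apply: eq_row_base.
have free2 : row_free (col_mx B C).
  have := full2; rewrite /row_free /row_full => /eqP ->; rewrite mxrank_compl.
  by rewrite subnKC // ltnW.
case: (h _ _ _ _ G H).
- apply: (@rsum_iso _ _ _ _ _ _ F G H 1%:M B 0 C) => //.
  + by move=> i; rewrite FB mul1mx.
  + by move=> i; rewrite [LHS]flatmx0 [RHS]flatmx0.
  + by rewrite /row_free -addsmxE addsmx0 mxrank1 addn0.
  + by rewrite /row_full -addsmxE addsmx0 mxrank1.
- lia.
- by rewrite add0n mxrank_compl => /eqP; rewrite subn_eq0 leqNgt lt.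
Qed.

Lemma gen_fullP m n (F : rep m n) :
  (forall A : 'M_n, (forall i, F i *m A = 0) -> A = 0) -> gen_full F.
Proof.
move=> h; have := h (cokermx (stack F)) => /(_ _) e.
have /e/eqP : forall i, F i *m cokermx (stack F) = 0.
  by move=> i; apply/eqP; rewrite -submxE arr_sub_stack.
rewrite -mxrank_eq0 mxrank_coker subn_eq0 => le.
by apply/eqP; rewrite eqn_leq rank_leq_col.
Qed.

Lemma gen_full_riso m n m' n' (F : rep m n) (F' : rep m' n') :
  riso F F' -> gen_full F -> gen_full F'.
Proof.
case=> f1 [f2] [g1] [g2] [h ab ba cd dc] gF; apply: gen_fullP => A e.
rewrite -[A]mul1mx -dc -mulmxA (_ : f2 *m A = 0) ?mulmx0 //.
by apply: (stack_mul0 gF) => i; rewrite mulmxA h -mulmxA e mulmx0.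
Qed.

Lemma gen_full_rsum m n m' n' (F : rep m n) (F' : rep m' n') :
  gen_full (rsum F F') -> gen_full F /\ gen_full F'.
Proof.
move=> g; split; apply: gen_fullP => A e.
  have : col_mx A (0 : 'M_(n', n)) == 0.
    apply/eqP; apply: (stack_mul0 g) => i.
    by rewrite /rsum mul_block_col e !mul0mx mulmx0 !addr0 col_mx0.
  by rewrite col_mx_eq0 => /andP[/eqP].
have : col_mx (0 : 'M_(n, n')) A == 0.
  apply/eqP; apply: (stack_mul0 g) => i.
  by rewrite /rsum mul_block_col e !mul0mx mulmx0 !addr0 col_mx0.
by rewrite col_mx_eq0 => /andP[_ /eqP].
Qed.

(** Both summands of a decomposition of G are again generated by their first components, so they
    reflect to a decomposition of F. *)
Lemma rindec_refl_pair m n p (F : rep m n) (G : rep m p) :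
  refl_pair F G -> rindec F -> rindec G.
Proof.
move=> c [nz h]; have [_ _ gG d] := c; split; first by lia.
move=> m1 n1 m2 n2 G1 G2 e.
have [/refl_pair_refl c1 /refl_pair_refl c2] := gen_full_rsum (gen_full_riso e gG).
have [_ _ _ d1] := c1; have [_ _ _ d2] := c2.
have := refl_pair_riso (refl_pair_sym c) (refl_pair_rsum c1 c2) e.
by case/h => ?; [left | right]; lia.
Qed.

(** The simple injective module, at which the descent by reflections ends. *)
Definition top_simple : rep 1 0 := fun=> 0.

Lemma rindec_top m (F : rep m 0) : rindec F -> riso F top_simple.
Proof.
case=> nz h; case: m F nz h => [//|[|m]] F nz h.
  by apply: riso_eq => i; rewrite [LHS]thinmx0 [RHS]thinmx0.
pose G : rep m.+1 0 := fun=> 0.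
case: (h _ _ _ _ top_simple G) => //.
by apply: riso_eq => i; rewrite [LHS]thinmx0 [RHS]thinmx0.
Qed.

Definition finite_upto_iso (P : forall m n, rep m n -> Prop) : Prop :=
  exists N (a b : 'I_N -> nat) (L : forall i, rep (a i) (b i)),
    forall m n (Y : rep m n), P m n Y -> exists i, riso Y (L i).

Definition rhom_nz m n m' n' (F : rep m n) (F' : rep m' n') : Prop :=
  exists f1 f2, rhom F F' f1 f2 /\ (f1 <> 0 \/ f2 <> 0).

Definition rpreproj m n (F : rep m n) :=
  finite_upto_iso (fun a b (Y : rep a b) => rindec Y /\ rhom_nz Y F).

Definition rpreinj m n (F : rep m n) :=
  finite_upto_iso (fun a b (Y : rep a b) => rindec Y /\ rhom_nz F Y).

Lemma rhom_nz_dual m n m' n' (F : rep m n) (F' : rep m' n') :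
  rhom_nz F F' -> rhom_nz (dual F') (dual F).
Proof.
case=> f1 [f2] [h nz]; exists f2^T, f1^T; split; first exact: rhom_dual.
by case: nz => z; [right | left] => e; apply: z; apply: trmx_inj; rewrite e trmx0.
Qed.

Lemma rhom_nz_riso m n m' n' m1 n1 m1' n1' (F : rep m n) (F' : rep m' n')
    (F1 : rep m1 n1) (F1' : rep m1' n1') :
  riso F F1 -> riso F' F1' -> rhom_nz F F' -> rhom_nz F1 F1'.
Proof.
case/riso_sym => f1 [f2] [g1] [g2] [h ab ba cd dc].
case=> f1' [f2'] [g1'] [g2'] [h' ab' _ cd' _] [u1] [u2] [hu nz].
exists (f1 *m u1 *m f1'), (f2 *m u2 *m f2'); split.
  by move=> i; rewrite !mulmxA h -(mulmxA f1) hu -!mulmxA h'.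
case: nz => z; [left | right] => e; apply: z.
  by rewrite -[u1]mulmx1 -ab' mulmxA -[u1]mul1mx -ba -(mulmxA g1) -(mulmxA g1) e mulmx0 mul0mx.
by rewrite -[u2]mulmx1 -cd' mulmxA -[u2]mul1mx -dc -(mulmxA g2) -(mulmxA g2) e mulmx0 mul0mx.
Qed.

Lemma riso_dualK m n (F : rep m n) : riso F (dual (dual F)).
Proof. exact/riso_sym/riso_eq/dualK. Qed.

Lemma rpreproj_riso m n m' n' (F : rep m n) (F' : rep m' n') :
  riso F F' -> rpreproj F -> rpreproj F'.
Proof.
move=> e [N] [a] [b] [L] h; exists N, a, b, L => x y Y [iY hY]; apply: h.
by split=> //; apply: (rhom_nz_riso (riso_refl Y) (riso_sym e)).
Qed.

Lemma rpreinj_riso m n m' n' (F : rep m n) (F' : rep m' n') :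
  riso F F' -> rpreinj F -> rpreinj F'.
Proof.
move=> e [N] [a] [b] [L] h; exists N, a, b, L => x y Y [iY hY]; apply: h.
by split=> //; apply: (rhom_nz_riso (riso_sym e) (riso_refl Y)).
Qed.

Lemma rpreproj_dual m n (F : rep m n) : rpreinj F -> rpreproj (dual F).
Proof.
case=> N [a] [b] [L] h; exists N, b, a, (fun i => dual (L i)) => x y Y [iY hY].
case: (h _ _ (dual Y)).
  split; first exact: rindec_dual.
  exact: rhom_nz_riso (riso_sym (riso_dualK F)) (riso_refl _) (rhom_nz_dual hY).
move=> i /riso_dual e; exists i; exact: riso_trans (riso_dualK Y) e.
Qed.

Lemma rpreinj_dual m n (F : rep m n) : rpreproj F -> rpreinj (dual F).
Proof.
case=> N [a] [b] [L] h; exists N, b, a, (fun i => dual (L i)) => x y Y [iY hY].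
case: (h _ _ (dual Y)).
  split; first exact: rindec_dual.
  exact: rhom_nz_riso (riso_refl _) (riso_sym (riso_dualK F)) (rhom_nz_dual hY).
move=> i /riso_dual e; exists i; exact: riso_trans (riso_dualK Y) e.
Qed.

Definition hom_defect a b x y (F : rep a b) (G : rep x y)
    (u : 'M[k]_(a, x) * 'M[k]_(b, y)) : {ffun 'I_3 -> 'M[k]_(a, y)} :=
  [ffun i => F i *m u.2 - u.1 *m G i].

Lemma hom_defect_linear a b x y (F : rep a b) (G : rep x y) :
  linear (hom_defect F G).
Proof.
move=> c u v; apply/ffunP => i; rewrite !ffunE /= !mulmxDl !mulmxDr.
by rewrite -!scalemxAl -!scalemxAr scalerBr opprD addrACA.
Qed.

HB.instance Definition _ a b x y (F : rep a b) (G : rep x y) :=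
  GRing.isLinear.Build k _ _ _ (hom_defect F G) (hom_defect_linear F G).

Lemma dim_matrix_pair a b x y :
  dim ('M[k]_(a, x) * 'M[k]_(b, y))%type = (a * x + b * y)%N.
Proof. by []. Qed.

Lemma dim_ffun_matrix a y :
  dim {ffun 'I_3 -> 'M[k]_(a, y)} = (3 * (a * y))%N.
Proof. by rewrite -[LHS]/(#|'I_3| * (a * y))%N card_ord. Qed.

(* The Euler form of the two dimension vectors bounds dim Hom from below. *)
Lemma rhom_nz_euler a b x y (F : rep a b) (G : rep x y) :
  (3 * (a * y) < a * x + b * y)%N -> rhom_nz F G.
Proof.
move=> lt; pose f := linfun (hom_defect F G).
have ker0 : (0 < \dim (lker f))%N.
  have := limg_ker_dim f fullv; rewrite capfv !dimvf.
  have := dimvS (subvf (limg f)); rewrite dimvf.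
  rewrite dim_matrix_pair dim_ffun_matrix.
  lia.
have u0 : vpick (lker f) != 0 by rewrite vpick0 -dimv_eq0 -lt0n.
have := memv_pick (lker f); rewrite memv_ker.
case: (vpick _) u0 => f1 f2 u0; rewrite lfunE /= => /eqP e.
exists f1, f2; split.
  by move=> i; have := congr1 (fun h : {ffun _ -> _} => h i) e; rewrite !ffunE /= => /eqP; rewrite subr_eq0 => /eqP.
case: (eqVneq f1 0) => [f10|/eqP]; last by left.
by right=> f20; move: u0; rewrite f10 f20 eqxx.
Qed.

End Fin.

(** * Preprojective and preinjective representations *)

Section Reg.
Variable k : fieldType.
Local Notation rep := (rep k).

Lemma rindec_top_simple : rindec (top_simple k).
Proof.
by split=> // m1 n1 m2 n2 G H /riso_dim [e1 e2]; lia.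
Qed.

Lemma rindec_dual_full m n (F : rep m n) :
  rindec F -> (0 < n)%N -> gen_full (dual F).
Proof. by move=> /rindec_dual iF n0; apply: rindec_full. Qed.

(** These are preprojective modules of dimension vectors (1, 3), (3, 8), (8, 21), ... Passing from
    (a, b) to (b, 3b - a) multiplies L2 by c, so the sign persists, and L2 < 0 forces a < b. *)
Lemma preproj_family N : exists a b (P : rep a b),
  [/\ rindec P, (0 < a)%N, L2 a b < 0 & (N <= a)%N].
Proof.
have := slope_bounds => sb.
elim: N => [|N [a] [b] [P] [iP a0 ab le]].
  have g : gen_full (top_simple k) by apply/eqP; rewrite -leqn0 rank_leq_col.
  have c := refl_pair_refl g; have [_ _ _ d] := c.
  exists _, _, (reflection (top_simple k)); split=> //.
    exact: rindec_refl_pair c rindec_top_simple.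
  by rewrite (_ : \rank _ = 3%N) /L2; [lra | lia].
have lt : (a < b)%N.
  by rewrite -(ltr_nat realalg); move: ab a0; rewrite /L2 -(ltr_nat realalg); nra.
have c := refl_pair_refl (rindec_dual_full iP (leq_ltn_trans (leq0n _) lt)).
have [_ _ _ d] := c.
exists _, _, (reflection (dual P)); split.
- exact: rindec_refl_pair c (rindec_dual iP).
- exact: leq_ltn_trans lt.
- have : (a%:R + (\rank (kermx (stack (dual P))))%:R = 3 * b%:R :> realalg).
    by rewrite -natrD d natrM.
  by move: ab; rewrite L2_swap pmulr_rlt0 ?coslope_gt0 // /L1 /L2; lra.
- exact: leq_ltn_trans lt.
Qed.

Lemma has_sub0 m n (F : rep m n) : has_sub F 0 0.
Proof.
by exists 0%N, 0%N, 0, 0; split; rewrite ?mxrank0 // => i; rewrite mul0mx sub0mx.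
Qed.

Lemma has_sub_full m n (F : rep m n) : has_sub F m n.
Proof.
by exists m, n, 1%:M, 1%:M; split; rewrite ?mxrank1 // => i; rewrite submx1.
Qed.

(** For P = (x, y) with y > (3 - c)x the Euler form xm + yn - 3xn is at least x(m - cn), which is
    positive when L2 is positive on F. Hence every P of the family maps nontrivially to F. *)
Lemma not_rpreproj m n (F : rep m n) :
  (0 < m + n)%N -> below_preproj F -> ~ rpreproj F.
Proof.
move=> nz tp [N] [a] [b] [L] h.
have := tp _ _ (has_sub0 F) nz; rewrite {2}/L2 !mulr0 subr0 subr0 => pos.
have [x [y] [P] [iP x0 xy le]] := preproj_family (\sum_i a i).+1.
have hP : rhom_nz P F.
  apply: rhom_nz_euler; rewrite -(ltr_nat realalg) natrD !natrM.
  have n0 : 0 <= n%:R :> realalg by rewrite ler0n.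
  move: pos xy x0; rewrite L2_swap_gt0 /L1 /L2 -(ltr_nat realalg).
  move: (n%:R : realalg) (m%:R : realalg) (x%:R : realalg) (y%:R : realalg) n0.
  by clear=> n m x y n0 pos xy x0; nra.
have [i /riso_dim [e _]] := h _ _ P (conj iP hP).
by move: le; rewrite e (bigD1 i) //=; lia.
Qed.

Lemma not_rpreinj m n (F : rep m n) :
  (0 < m + n)%N -> above_preinj F -> ~ rpreinj F.
Proof.
move=> nz fi /rpreproj_dual; apply: not_rpreproj; first by rewrite addnC.
exact: below_preproj_dual.
Qed.

Lemma finite_upto_isoU (P Q R : forall m n, rep m n -> Prop) :
  finite_upto_iso P -> finite_upto_iso Q ->
  (forall m n (Y : rep m n), R m n Y -> P m n Y \/ Q m n Y) ->
  finite_upto_iso R.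
Proof.
case=> N [a] [b] [L] hL [N'] [a'] [b'] [L'] hL' hR.
pose A (s : 'I_N + 'I_N') := match s with inl j => a j | inr j => a' j end.
pose B (s : 'I_N + 'I_N') := match s with inl j => b j | inr j => b' j end.
pose LL (s : 'I_N + 'I_N') : rep (A s) (B s) :=
  match s with inl j => L j | inr j => L' j end.
exists (N + N')%N, (fun i => A (split i)), (fun i => B (split i)),
  (fun i => LL (split i)) => m n Y /hR [/hL [i e]|/hL' [i e]].
  by exists (unsplit (inl i)); rewrite unsplitK.
by exists (unsplit (inr i)); rewrite unsplitK.
Qed.

Lemma finite_upto_iso1 x y (X : rep x y) (P : forall m n, rep m n -> Prop) :
  (forall m n (Y : rep m n), P m n Y -> riso Y X) -> finite_upto_iso P.
Proof.
by move=> h; exists 1%N, (fun=> x), (fun=> y), (fun=> X) => m n Y /h; exists ord0.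
Qed.

Lemma dual_full_mul0 m n (F : rep m n) p (A : 'M_(p, m)) :
  gen_full (dual F) -> (forall i, A *m F i = 0) -> A = 0.
Proof.
move=> gF e; apply: trmx_inj; rewrite trmx0; apply: (stack_mul0 gF) => i.
by rewrite /dual -trmx_mul e trmx0.
Qed.

(** Apart from the simple injective module, an indecomposable Y is recovered from the reflection of
    its dual, and a nonzero map from F to Y induces a nonzero map between the reflected modules. So
    finiteness passes back to F. *)
Lemma rpreinj_step m n (F : rep m n) :
  gen_full (dual F) -> rpreinj (reflection (dual F)) -> rpreinj F.
Proof.
move=> gF [N] [a] [b] [L] h; have cF := refl_pair_refl gF.
pose P1 x y (Y : rep x y) := rindec Y /\ y = 0%N.
pose P2 x y (Y : rep x y) := [/\ rindec Y, rhom_nz F Y & (0 < y)%N].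
apply: (@finite_upto_isoU P1 P2).
- apply: (@finite_upto_iso1 _ _ (top_simple k)) => x y Y [iY y0]; subst y.
  exact: rindec_top.
- exists N, (fun i => \rank (kermx (stack (L i)))), a,
    (fun i => dual (reflection (L i))) => x y Y [iY [f1] [f2] [hf nz] y0].
  have gY := rindec_dual_full iY y0; have cY := refl_pair_refl gY.
  have [g2] := refl_pair_hom cY cF (rhom_dual hf); rewrite trmxK => hg.
  have f20 : f2 <> 0.
    move=> f20; case: nz => [z|//]. case: z; apply: (dual_full_mul0 gY) => i.
    by rewrite -hf f20 mulmx0.
  case: (h _ _ (reflection (dual Y))).
    split; first exact: rindec_refl_pair cY (rindec_dual iY).
    by exists f2, g2; split=> //; left.
  move=> i e; exists i; have [_ _ g _] := cY.
  have := refl_pair_riso (refl_pair_sym cY) (refl_pair_refl (gen_full_riso e g)) e.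
  by move/riso_dual; apply: riso_trans (riso_dualK Y).
- move=> x y Y [iY hY]; case: (posnP y) => y0; first by left.
  by right.
Qed.

Definition unstable m n (F : rep m n) :=
  exists a b, [/\ has_sub F a b, (0 < a + b)%N & L1 a b <= 0].

Lemma above_preinjVunstable m n (F : rep m n) : above_preinj F \/ unstable F.
Proof.
case: (classic (unstable F)) => u; [by right | left=> a b h nz].
by rewrite ltNge; apply/negP => le; apply: u; exists a, b.
Qed.

(* Reflecting F keeps a destabilizing submodule while shrinking its first
   dimension, so that F ends up as the simple injective module. *)
Lemma rindec_unstable_rpreinj m n (F : rep m n) :
  rindec F -> unstable F -> rpreinj F.
Proof.
move=> iF [a] [b] []; move: {2}a (leqnn a) => N; have := slope_bounds => sb.
elim: N m n F iF a b => [|N IHN] m n F iF a b le s nz neg.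
  by move: le nz neg; rewrite leqn0 => /eqP ->; rewrite add0n /L1 -(ltr_nat realalg); lra.
have [am bn] := has_sub_leq s.
case: (posnP n) => n0.
  subst n; apply: rpreinj_riso (riso_sym (rindec_top iF)) _.
  apply: (@finite_upto_iso1 _ _ (top_simple k)) => x y Y [iY [f1] [f2] [hf nzf]].
  case: (posnP y) => y0; first by subst y; apply: rindec_top.
  case: nzf; last by rewrite [f2]flatmx0.
  case; apply: (dual_full_mul0 (rindec_dual_full iY y0)) => i.
  by rewrite -hf mul0mx.
have gF := rindec_dual_full iF n0; have c := refl_pair_refl gF.
apply: (rpreinj_step gF).
have [b' s' le'] := has_sub_refl_pair c (has_sub_dual s).
rewrite subKn // in s' le'.
have le2 : (b' + a <= 3 * b)%N by lia.
(* L1 <= 0 means b <= ca with c < 1. The reflected submodule has first dimension b, so the induction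
   parameter drops. *)
have ba : (b < a)%N.
  rewrite -(ltr_nat realalg); move: neg nz; rewrite /L1 -(ltr_nat realalg) natrD.
  by have := ler0n realalg a; have := ler0n realalg b; nra.
apply: (IHN _ _ (reflection (dual F)) _ b b' _ s'); [|by lia|by lia|].
  exact: rindec_refl_pair c (rindec_dual iF).
move: le2 neg; rewrite -(ler_nat realalg) natrD natrM.
by rewrite L1_swap pmulr_rle0 ?slope_gt0 // /L1 /L2; lra.
Qed.

(** A direct summand given by a split embedding, with no complement named; [retract_complement]
    supplies one. *)
Definition retract m n m' n' (X : rep m n) (F : rep m' n') :=
  exists i1 i2 p1 p2, [/\ rhom X F i1 i2, rhom F X p1 p2,
    i1 *m p1 = 1%:M & i2 *m p2 = 1%:M].

Lemma retract_refl m n (F : rep m n) : retract F F.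
Proof.
exists 1%:M, 1%:M, 1%:M, 1%:M.
by split; rewrite ?mulmx1 // => i; rewrite mul1mx mulmx1.
Qed.

Lemma rhom_comp m n m1 n1 m2 n2 (F : rep m n) (G : rep m1 n1) (H : rep m2 n2)
   f1 f2 g1 g2 : rhom F G f1 f2 -> rhom G H g1 g2 ->
   rhom F H (f1 *m g1) (f2 *m g2).
Proof. by move=> hf hg i; rewrite mulmxA hf -!mulmxA hg. Qed.

Lemma retract_trans m n m1 n1 m2 n2 (F : rep m n) (G : rep m1 n1)
  (H : rep m2 n2) : retract F G -> retract G H -> retract F H.
Proof.
case=> i1 [i2] [p1] [p2] [hi hp e1 e2] [j1] [j2] [q1] [q2] [hj hq e1' e2'].
exists (i1 *m j1), (i2 *m j2), (q1 *m p1), (q2 *m p2).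
split; [exact: rhom_comp hi hj | exact: rhom_comp hq hp | |].
  by rewrite mulmxA -(mulmxA i1) e1' mulmx1.
by rewrite mulmxA -(mulmxA i2) e2' mulmx1.
Qed.

Lemma retract_riso m n m1 n1 (F : rep m n) (G : rep m1 n1) :
  riso F G -> retract F G.
Proof.
move=> /[dup] /riso_sym [f1'] _ []; rewrite {f1'} => f1 [f2] [g1] [g2] [h a b c d].
exists f1, f2, g1, g2; split=> // i.
by rewrite -[G i]mul1mx -b -(mulmxA g1) -h -!mulmxA c mulmx1.
Qed.

Lemma retract_dual m n m1 n1 (F : rep m n) (G : rep m1 n1) :
  retract F G -> retract (dual F) (dual G).
Proof.
case=> i1 [i2] [p1] [p2] [hi hp e1 e2]; exists p2^T, p1^T, i2^T, i1^T.
by split; [exact: rhom_dual | exact: rhom_dual | |]; rewrite -trmx_mul ?e1 ?e2 trmx1.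
Qed.

Lemma retract_suml m n m1 n1 (F : rep m n) (G : rep m1 n1) :
  retract F (rsum F G).
Proof.
exists (row_mx 1%:M 0), (row_mx 1%:M 0), (col_mx 1%:M 0), (col_mx 1%:M 0).
split; try by rewrite mul_row_col mulmx1 mulmx0 addr0.
- by move=> i; rewrite /rsum mul_row_block !mul0mx !mulmx0 mul1mx mul_mx_row mulmx1 mulmx0 !addr0.
- by move=> i; rewrite /rsum mul_block_col !mul0mx !mulmx0 mulmx1 mul_col_mx mul1mx mul0mx !addr0.
Qed.

Lemma retract_sumr m n m1 n1 (F : rep m n) (G : rep m1 n1) :
  retract G (rsum F G).
Proof.
exists (row_mx 0 1%:M), (row_mx 0 1%:M), (col_mx 0 1%:M), (col_mx 0 1%:M).
split; try by rewrite mul_row_col mulmx1 mulmx0 add0r.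
- by move=> i; rewrite /rsum mul_row_block !mul0mx !mulmx0 mul1mx mul_mx_row mulmx1 mulmx0 !add0r.
- by move=> i; rewrite /rsum mul_block_col !mul0mx !mulmx0 mulmx1 mul_col_mx mul1mx mul0mx !add0r.
Qed.

Lemma has_sub_retract m n m1 n1 (F : rep m n) (G : rep m1 n1) a b :
  retract F G -> has_sub F a b -> has_sub G a b.
Proof.
case=> i1 [i2] [p1] [p2] [hi hp e1 e2] [p] [q] [U1] [U2] [s <- <-].
exists p, q, (U1 *m i1), (U2 *m i2).
have r1 : row_free i1 by apply/row_freeP; exists p1.
have r2 : row_free i2 by apply/row_freeP; exists p2.
by split; rewrite ?mxrankMfree // => i; rewrite -mulmxA -hi mulmxA submxMr.
Qed.

Lemma above_preinj_retract m n m1 n1 (F : rep m n) (G : rep m1 n1) :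
  retract F G -> above_preinj G -> above_preinj F.
Proof. by move=> r h a b /(has_sub_retract r); apply: h. Qed.

Lemma below_preproj_retract m n m1 n1 (F : rep m n) (G : rep m1 n1) :
  retract F G -> below_preproj G -> below_preproj F.
Proof.
move=> /retract_dual r /above_preinj_dual /(above_preinj_retract r).
move=> /below_preproj_dual h a b s; apply: h.
exact: has_sub_riso (riso_dualK F) s.
Qed.

End Reg.

(** * Regular representations *)

Section Exact.
Variable k : fieldType.
Local Notation rep := (rep k).

Lemma rank_mul_cap_ker p m q r (U : 'M[k]_(p, m)) (f : 'M_(m, q)) (g : 'M_(m, r)) :
  (kermx f :&: kermx g)%MS = 0 ->
  (\rank ((U :&: kermx f)%MS *m g) + \rank (U *m f) = \rank U)%N.
Proof.
move=> e; have := mxrank_mul_ker (U :&: kermx f)%MS g; have -> : (U :&: kermx f :&: kermx g)%MS = 0.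
  by apply/eqP; rewrite -submx0 -e sub_capmx capmxSr (submx_trans (capmxSl _ _)) ?capmxSr.
by rewrite mxrank0 addn0 => ->; rewrite addnC mxrank_mul_ker.
Qed.

Lemma ker_proj_rsum m1 m2 :
  (kermx (col_mx 0 1%:M : 'M[k]_(m1 + m2, m2)) :&:
   kermx (col_mx 1%:M 0 : 'M[k]_(m1 + m2, m1)))%MS = 0.
Proof.
apply/eqP; rewrite -submx0; apply/rV_subP => v; rewrite sub_capmx !sub_kermx.
rewrite -[v]hsubmxK !mul_row_col !mulmx1 !mulmx0 add0r addr0.
by move=> /andP[/eqP -> /eqP ->]; rewrite row_mx0 sub0mx.
Qed.

(** A submodule of the sum contributes its intersection with G and its projection to H. *)
Lemma has_sub_rsum m1 n1 m2 n2 (G : rep m1 n1) (H : rep m2 n2) a b :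
  has_sub (rsum G H) a b -> exists a1 b1 a2 b2,
    [/\ has_sub G a1 b1, has_sub H a2 b2, (a1 + a2)%N = a & (b1 + b2)%N = b].
Proof.
case=> p [q] [U1] [U2] [s <- <-].
rewrite -(rank_mul_cap_ker U1 (ker_proj_rsum m1 m2)).
rewrite -(rank_mul_cap_ker U2 (ker_proj_rsum n1 n2)).
set pr1 : 'M_(m1 + m2, m2) := col_mx 0 1%:M; set la1 : 'M_(m1 + m2, m1) := col_mx 1%:M 0.
set pr2 : 'M_(n1 + n2, n2) := col_mx 0 1%:M; set la2 : 'M_(n1 + n2, n1) := col_mx 1%:M 0.
have hp : rhom (rsum G H) H pr1 pr2.
  by move=> i; rewrite /rsum mul_block_col !mul0mx !mulmx0 mulmx1 mul_col_mx mul1mx mul0mx !add0r.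
have hl : rhom (rsum G H) G la1 la2.
  by move=> i; rewrite /rsum mul_block_col !mul0mx !mulmx0 mulmx1 mul_col_mx mul1mx mul0mx !addr0.
exists (\rank ((U1 :&: kermx pr1)%MS *m la1)), (\rank ((U2 :&: kermx pr2)%MS *m la2)),
  (\rank (U1 *m pr1)), (\rank (U2 *m pr2)); split=> //.
- exists _, _, ((U1 :&: kermx pr1)%MS *m la1), ((U2 :&: kermx pr2)%MS *m la2).
  split=> // i; rewrite -mulmxA -hl mulmxA submxMr // sub_capmx.
  rewrite (submx_trans (submxMr _ (capmxSl _ _)) (s i)) sub_kermx -mulmxA hp mulmxA.
  by rewrite (sub_kermxP (capmxSr U1 (kermx pr1))) mul0mx eqxx.
- exists _, _, (U1 *m pr1), (U2 *m pr2); split=> // i.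
  by rewrite -mulmxA -hp mulmxA submxMr.
Qed.

Lemma L1D a b a' b' : L1 (a + a') (b + b') = L1 a b + L1 a' b'.
Proof. by rewrite /L1 !natrD; ring. Qed.

Lemma L2D a b a' b' : L2 (a + a') (b + b') = L2 a b + L2 a' b'.
Proof. by rewrite /L2 !natrD; ring. Qed.

(** L1 is additive, so one of the two summands of a decomposable unstable module is unstable;
    induction on the dimension reaches an indecomposable one. *)
Lemma unstable_retract m n (F : rep m n) : unstable F ->
  exists a b (X : rep a b), [/\ rindec X, retract X F & rpreinj X].
Proof.
move: {2}(m + n)%N (leqnn (m + n)) => N; elim: N m n F => [|N IHN] m n F le uF.
  by case: uF => a [b] [/has_sub_leq [? ?] ? _]; lia.
case: (classic (rindec F)) => iF.
  exists m, n, F; split=> //; first exact: retract_refl.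
  exact: rindec_unstable_rpreinj.
have nz : (0 < m + n)%N by case: uF => a [b] [/has_sub_leq [? ?] ? _]; lia.
have [m1 [n1 [m2 [n2 [G [H [e z1 z2]]]]]]] : exists m1 n1 m2 n2 (G : rep m1 n1)
    (H : rep m2 n2), [/\ riso F (rsum G H), (0 < m1 + n1)%N & (0 < m2 + n2)%N].
  apply: NNPP => no; apply: iF; split=> // m1 n1 m2 n2 G H e.
  case: (posnP (m1 + n1)) => z1; first by left.
  case: (posnP (m2 + n2)) => z2; first by right.
  by case: no; exists m1, n1, m2, n2, G, H.
have [em en] := riso_dim e.
have [u|u] : unstable G \/ unstable H.
  case: uF => a [b] [/(has_sub_riso e) /has_sub_rsum [a1] [b1] [a2] [b2]].
  case=> s1 s2 <- <- nz' le'.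
  case: (above_preinjVunstable G) => [p1|]; last by left.
  case: (above_preinjVunstable H) => [p2|]; last by right.
  exfalso; move: le'; rewrite L1D leNgt => /negP; apply.
  have L0 : L1 0 0 = 0 by rewrite /L1; ring.
  case: (posnP (a1 + b1)) => q1; last first.
    have := p1 _ _ s1 q1; case: (posnP (a2 + b2)) => q2; last first.
      by have := p2 _ _ s2 q2; lra.
    have [-> ->] : a2 = 0%N /\ b2 = 0%N by lia.
    by rewrite L0; lra.
  have [ea eb] : a1 = 0%N /\ b1 = 0%N by lia.
  rewrite ea eb L0 add0r; apply: p2 => //; lia.
- have [|a [b [X [iX rX pX]]]] := IHN _ _ G _ u; first lia.
  exists a, b, X; split=> //; apply: (retract_trans rX).
  apply: (retract_trans (retract_suml G H)).
  exact/retract_riso/riso_sym.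
- have [|a [b [X [iX rX pX]]]] := IHN _ _ H _ u; first lia.
  exists a, b, X; split=> //; apply: (retract_trans rX).
  apply: (retract_trans (retract_sumr G H)).
  exact/retract_riso/riso_sym.
Qed.

Definition rregular m n (F : rep m n) :=
  forall a b (X : rep a b), rindec X -> retract X F ->
    ~ rpreproj X /\ ~ rpreinj X.

Lemma rregular_dual m n (F : rep m n) : rregular F -> rregular (dual F).
Proof.
move=> h a b X iX rX.
have r : retract (dual X) F.
  apply: (retract_trans (retract_dual rX)).
  exact/retract_riso/riso_sym/riso_dualK.
have [np ni] := h _ _ _ (rindec_dual iX) r.
by split=> [/rpreinj_dual|/rpreproj_dual].
Qed.

Lemma rregular_above m n (F : rep m n) : rregular F -> above_preinj F.
Proof.
move=> h; case: (above_preinjVunstable F) => // /unstable_retract.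
by case=> a [b] [X] [iX rX pX]; case: (h _ _ X iX rX).
Qed.

Lemma rregularP m n (F : rep m n) :
  rregular F <-> above_preinj F /\ below_preproj F.
Proof.
split=> [h|[fi tp] a b X [nz iX] rX].
  split; first exact: rregular_above.
  have := below_preproj_dual (rregular_above (rregular_dual h)).
  by move=> t a b s; apply: t; apply: has_sub_riso (riso_dualK F) s.
split; first exact: not_rpreproj nz (below_preproj_retract rX tp).
exact: not_rpreinj nz (above_preinj_retract rX fi).
Qed.

Lemma exists_argmax (T : eqType) (s : seq T) (P : T -> Prop) (f : T -> realalg) x0 :
  x0 \in s -> P x0 ->
  exists2 x, P x & forall y, y \in s -> P y -> f y <= f x.
Proof.
elim: s x0 => [//|z s IHs] x0 x0s Px0.
case: (classic (exists2 x, x \in s & P x)) => [[x xs Px]|no].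
  have [y Py hy] := IHs x xs Px.
  case: (classic (P z /\ f y <= f z)) => [[Pz le]|nz].
    exists z => // t; rewrite inE => /predU1P[->//|ts Pt].
    exact: le_trans (hy t ts Pt) le.
  exists y => // t; rewrite inE => /predU1P[-> Pz|]; last exact: hy.
  by rewrite leNgt; apply/negP => lt; apply: nz; split=> //; apply: ltW.
exists x0 => // t; rewrite inE => /predU1P[->|ts Pt]; last by case: no; exists t.
by move: x0s; rewrite inE => /predU1P[<-//|x0s]; case: no; exists x0.
Qed.

Lemma exists_argmax_nat m n (P : nat -> nat -> Prop) (f : nat -> nat -> realalg) :
  (forall a b, P a b -> (a <= m)%N /\ (b <= n)%N) -> (exists a b, P a b) ->
  exists a b, P a b /\ forall a' b', P a' b' -> f a' b' <= f a b.
Proof.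
move=> bd [a [b ab]].
have inS a' b' : P a' b' -> (a', b') \in [seq (i, j) | i <- iota 0 m.+1, j <- iota 0 n.+1].
  by move=> /bd [le1 le2]; apply/allpairsP; exists (a', b'); rewrite !mem_iota !ltnS.
have [[x y] Pxy h] := @exists_argmax _ _ (fun z => P z.1 z.2) (fun z => f z.1 z.2)
  _ (inS _ _ ab) ab.
by exists x, y; split=> // a' b' p; apply: (h (a', b')) => //; apply: inS.
Qed.

Lemma sub_add m n (F : rep m n) p q p' q' (U1 : 'M_(p, m)) (U2 : 'M_(q, n))
    (W1 : 'M_(p', m)) (W2 : 'M_(q', n)) :
  subrep F U1 U2 -> subrep F W1 W2 -> subrep F (U1 + W1)%MS (U2 + W2)%MS.
Proof.
by move=> s t i; rewrite addsmxMr addsmxS.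
Qed.

Lemma sub_cap m n (F : rep m n) p q p' q' (U1 : 'M_(p, m)) (U2 : 'M_(q, n))
    (W1 : 'M_(p', m)) (W2 : 'M_(q', n)) :
  subrep F U1 U2 -> subrep F W1 W2 -> subrep F (U1 :&: W1)%MS (U2 :&: W2)%MS.
Proof.
move=> s t i; rewrite sub_capmx.
rewrite (submx_trans (submxMr _ (capmxSl _ _)) (s i)).
by rewrite (submx_trans (submxMr _ (capmxSr _ _)) (t i)).
Qed.

(* Torsion submodules: R is the largest part of U with respect to L2, and V is
   the L1-minimal submodule containing R. *)
Lemma splitting_truncate m n (F : rep m n) : splitting F ->
  exists (V1 : 'M[k]_m) (V2 : 'M[k]_n), [/\ subrep F V1 V2,
    (0 < \rank V1 + \rank V2 < m + n)%N,
    forall p q (W1 : 'M_(p, m)) (W2 : 'M_(q, n)), subrep F W1 W2 ->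
      (W1 <= V1)%MS -> (W2 <= V2)%MS ->
      (\rank W1 + \rank W2 < \rank V1 + \rank V2)%N ->
      0 < L2 (\rank V1) (\rank V2) - L2 (\rank W1) (\rank W2)
  & forall p q (W1 : 'M_(p, m)) (W2 : 'M_(q, n)), subrep F W1 W2 ->
      (V1 <= W1)%MS -> (V2 <= W2)%MS ->
      (\rank V1 + \rank V2 < \rank W1 + \rank W2)%N ->
      0 < L1 (\rank W1) (\rank W2) - L1 (\rank V1) (\rank V2)].
Proof.
case=> a [b] [[p] [q] [U1] [U2] [sU <- <-]] posU posQ {a b}.
pose P a b := exists (R1 : 'M[k]_m) (R2 : 'M[k]_n), [/\ subrep F R1 R2,
  (R1 <= U1)%MS && (R2 <= U2)%MS, \rank R1 = a & \rank R2 = b].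
have bdP a b : P a b -> (a <= m)%N /\ (b <= n)%N.
  by move=> [R1] [R2] [_ _ <- <-]; rewrite !rank_leq_col.
have PU : P (\rank U1) (\rank U2).
  exists <<U1>>%MS, <<U2>>%MS.
  by rewrite !genmxE !submx_refl; split=> // i; rewrite genmxE (eqmxMr _ (genmxE _)).
have [|a [b [[R1 [R2 [sR /andP[R1U R2U] <- <-]]] maxR]]] := exists_argmax_nat L2 bdP.
  by exists (\rank U1), (\rank U2).
have RU := maxR _ _ PU.
pose Q a b := exists (V1 : 'M[k]_m) (V2 : 'M[k]_n), [/\ subrep F V1 V2,
  (R1 <= V1)%MS && (R2 <= V2)%MS, \rank V1 = a & \rank V2 = b].
have bdQ c d : Q c d -> (c <= m)%N /\ (d <= n)%N.
  by move=> [V1] [V2] [_ _ <- <-]; rewrite !rank_leq_col.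
have [|c [d [[V1 [V2 [sV /andP[R1V R2V] <- <-]]] maxV]]] :=
    exists_argmax_nat (fun a b => - L1 a b) bdQ.
  by exists (\rank R1), (\rank R2), R1, R2; rewrite !submx_refl.
have minV p' q' (W1 : 'M_(p', m)) (W2 : 'M_(q', n)) : subrep F W1 W2 ->
    (R1 <= W1)%MS -> (R2 <= W2)%MS ->
    L1 (\rank V1) (\rank V2) <= L1 (\rank W1) (\rank W2).
  move=> sW RW1 RW2; rewrite -lerN2; apply: maxV; exists <<W1>>%MS, <<W2>>%MS.
  rewrite !genmxE RW1 RW2; split=> // i.
  by rewrite genmxE (eqmxMr _ (genmxE _)).
have L20 : L2 0 0 = 0 by rewrite /L2; ring.
exists V1, V2; split=> //.
- apply/andP; split.
    rewrite lt0n; apply/eqP => e.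
    have [z1 z2] : \rank R1 = 0%N /\ \rank R2 = 0%N.
      by have := mxrankS R1V; have := mxrankS R2V; lia.
    by move: RU posU; rewrite z1 z2 L20; lra.
  rewrite ltnNge; apply/negP => le.
  have [z1 z2] : \rank V1 = m /\ \rank V2 = n.
    by have := rank_leq_col V1; have := rank_leq_col V2; lia.
  have := minV _ _ U1 U2 sU R1U R2U; rewrite z1 z2; move: posQ; lra.
- move=> p' q' W1 W2 sW W1V W2V lt.
  (* Modularity: L2 (W) + L2 (R) = L2 (W + R) + L2 (W meet R). Maximality of R gives L2 (W) <= L2 (W
     + R), and L1-minimality of V gives L1 <= 0, hence L2 >= 0, on V / (W + R). *)
  have S1 := mxrank_sum_cap W1 R1; have S2 := mxrank_sum_cap W2 R2.
  have sc := sub_cap sW sR; have sa := sub_add sW sR.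
  have h1 : L2 (\rank (W1 :&: R1)%MS) (\rank (W2 :&: R2)%MS) <= L2 (\rank R1) (\rank R2).
    apply: maxR; exists (W1 :&: R1)%MS, (W2 :&: R2)%MS; split=> //.
    by rewrite (submx_trans (capmxSr _ _) R1U) (submx_trans (capmxSr _ _) R2U).
  have h2 := minV _ _ _ _ sa (addsmxSr _ _) (addsmxSr _ _).
  have i1 : (\rank (W1 + R1)%MS <= \rank V1)%N by rewrite mxrankS // addsmx_sub W1V.
  have i2 : (\rank (W2 + R2)%MS <= \rank V2)%N by rewrite mxrankS // addsmx_sub W2V.
  have j1 := mxrankS W1V; have j2 := mxrankS W2V.
  (* Equality would make L2 vanish on the nonzero factor module V / W. *)
  rewrite lt_neqAle; apply/andP; split.
    apply/eqP => /esym; rewrite -L2_sub // => /L2_eq0; lia.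
  move: h1 h2; have : L2 (\rank (W1 + R1)%MS + \rank (W1 :&: R1)%MS)
     (\rank (W2 + R2)%MS + \rank (W2 :&: R2)%MS) =
     L2 (\rank W1 + \rank R1) (\rank W2 + \rank R2) by rewrite S1 S2.
  rewrite !L2D; move: i1 i2; rewrite -!(ler_nat realalg) /L1 /L2.
  have := slope_bounds; nra.
- move=> p' q' W1 W2 sW VW1 VW2 lt.
  have j1 := mxrankS VW1; have j2 := mxrankS VW2.
  rewrite lt_neqAle; apply/andP; split.
    by apply/eqP => /esym; rewrite -L1_sub // => /L1_eq0; lia.
  rewrite subr_ge0; apply: minV => //; exact: submx_trans VW1 || exact: submx_trans VW2.
Qed.

End Exact.

(** * Elementary representations *)

Section Elem.
Variable k : fieldType.
Local Notation rep := (rep k).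

Definition rexact v1 v2 m n w1 w2 (S : rep v1 v2) (F : rep m n) (Q : rep w1 w2)
    f1 f2 g1 g2 :=
  [/\ rhom S F f1 f2, rhom F Q g1 g2, row_free f1 && row_free f2,
    row_full g1 && row_full g2 & (f1 == kermx g1)%MS && (f2 == kermx g2)%MS].

Definition relementary m n (F : rep m n) :=
  [/\ (0 < m + n)%N, rregular F & ~ exists v1 v2 w1 w2 (S : rep v1 v2)
    (Q : rep w1 w2) f1 f2 g1 g2, [/\ rexact S F Q f1 f2 g1 g2,
      (0 < v1 + v2)%N, rregular S, (0 < w1 + w2)%N & rregular Q]].

Lemma sub_restrict m n (F : rep m n) (V1 : 'M[k]_m) (V2 : 'M[k]_n) :
  subrep F V1 V2 -> exists (S : rep (\rank V1) (\rank V2)) f1 f2,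
    [/\ rhom S F f1 f2, row_free f1 && row_free f2 &
        (f1 == V1)%MS && (f2 == V2)%MS].
Proof.
move=> s; exists (fun i => row_base V1 *m F i *m pinvmx (row_base V2)).
exists (row_base V1), (row_base V2).
rewrite !row_base_free !eq_row_base !submx_refl; split=> // i.
rewrite mulmxKpV // eq_row_base (submx_trans _ (s i)) // submxMr //.
by rewrite eq_row_base.
Qed.

Lemma has_sub_mono m n v1 v2 (S : rep v1 v2) (F : rep m n) f1 f2 p q
    (U1 : 'M_(p, v1)) (U2 : 'M_(q, v2)) :
  rhom S F f1 f2 -> subrep S U1 U2 -> subrep F (U1 *m f1) (U2 *m f2).
Proof. by move=> h s i; rewrite -mulmxA -h mulmxA submxMr. Qed.

(** The factor module by V is realised as the dual of the annihilator T of V in the dual of F, so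
    only submodules need restricting. S and T inherit one condition each from F and its dual; the
    extremality of V provides the other two. *)
Lemma splitting_exact m n (F : rep m n) :
  above_preinj F -> below_preproj F -> splitting F ->
  exists v1 v2 w1 w2 (S : rep v1 v2)
    (Q : rep w1 w2) f1 f2 g1 g2, [/\ rexact S F Q f1 f2 g1 g2,
      (0 < v1 + v2)%N, rregular S, (0 < w1 + w2)%N & rregular Q].
Proof.
move=> fi tp /splitting_truncate [V1] [V2] [sV /andP[vpos vlt] subV supV].
have [S [f1 [f2 [hf /andP[fr1 fr2] /andP[/eqmxP e1 /eqmxP e2]]]]] := sub_restrict sV.
have [T [h2 [h1 [hh /andP[fr4 fr3] /andP[/eqmxP d2 /eqmxP d1]]]]] :=
  sub_restrict (sub_dual sV).
have le1 := rank_leq_col V1; have le2 := rank_leq_col V2.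
have hs p q (U1 : 'M_(p, \rank V1)) (U2 : 'M_(q, \rank V2)) : subrep S U1 U2 ->
    [/\ subrep F (U1 *m f1) (U2 *m f2), (U1 *m f1 <= V1)%MS, (U2 *m f2 <= V2)%MS,
        \rank (U1 *m f1) = \rank U1 & \rank (U2 *m f2) = \rank U2].
  move=> s; rewrite !mxrankMfree // !(submx_trans (submxMl _ _)) ?e1 ?e2 //.
  by split=> //; apply: has_sub_mono hf s.
have ht p q (U1 : 'M_(p, \rank (perp V2))) (U2 : 'M_(q, \rank (perp V1))) :
    subrep T U1 U2 ->
    [/\ subrep F (perp (U2 *m h1)) (perp (U1 *m h2)),
        (V1 <= perp (U2 *m h1))%MS, (V2 <= perp (U1 *m h2))%MS,
        \rank (perp (U2 *m h1)) = (m - \rank U2)%N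
      & \rank (perp (U1 *m h2)) = (n - \rank U1)%N].
  move=> s; split.
  - by move=> i; rewrite -(dualK F i); apply: (sub_dual (has_sub_mono hh s)).
  - by rewrite sub_perp_sym (submx_trans (submxMl _ _)) ?d1.
  - by rewrite sub_perp_sym (submx_trans (submxMl _ _)) ?d2.
  - by rewrite (rank_perp (U2 *m h1)) mxrankMfree.
  - by rewrite (rank_perp (U1 *m h2)) mxrankMfree.
have exh p (V : 'M[k]_(p, p)) (f : 'M_(\rank V, p)) h : (f :=: V)%MS ->
   (h :=: perp V)%MS -> (f == kermx h^T)%MS.
  move=> ef eh; have /andP[s1 s2] := perp_perp V.
  have le : (perp h <= perp (perp V))%MS by rewrite perpS // eh.
  have ge : (perp (perp V) <= perp h)%MS by rewrite perpS // eh.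
  by rewrite -[kermx _]/(perp h) !ef (submx_trans le s1) (submx_trans s2 ge).
have abS : above_preinj S.
  by move=> a b [p] [q] [U1] [U2] [/hs [s _ _ r1 r2] <- <-]; apply: fi; exists p, q, (U1 *m f1), (U2 *m f2).
have abT : above_preinj T.
  move=> a b [p] [q] [U1] [U2] [s <- <-]; apply: (above_preinj_dual tp).
  exists p, q, (U1 *m h2), (U2 *m h1); rewrite !mxrankMfree //; split=> //.
  exact: has_sub_mono hh s.
have beS : below_preproj S.
  move=> a b [p] [q] [U1] [U2] [/hs [s i1 i2 r1 r2] <- <-]; rewrite -r1 -r2 => lt.
  exact: subV.
have beT : below_preproj T.
  move=> a b [p] [q] [U1] [U2] [/ht [s i1 i2 r1 r2] <- <-] lt.
  have := rank_leq_col U1; have := rank_leq_col U2 => l2 l1.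
  have := supV _ _ _ _ s i1 i2; rewrite r1 r2.
  move: lt l1 l2; move: (\rank U1) (\rank U2) => u1 u2; rewrite !rank_perp => lt l1 l2.
  have lu1 : (u1 <= n)%N by rewrite (leq_trans l1) ?leq_subr.
  have lu2 : (u2 <= m)%N by rewrite (leq_trans l2) ?leq_subr.
  rewrite -L2_sub // L2_swap_gt0 !L1_sub ?leq_subr //.
  have -> : (\rank V1 + \rank V2 < m - u2 + (n - u1))%N by lia.
  by move=> /(_ isT); lra.
exists _, _, _, _, S, (dual T), f1, f2, h1^T, h2^T; split=> //.
- split=> //.
  + by move=> i; have := rhom_dual hh i; rewrite dualK.
  + by rewrite fr1.
  + by rewrite /row_full !mxrank_tr; move: fr3 fr4; rewrite /row_free => -> ->.
  + by rewrite !exh.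
- exact/rregularP.
- by rewrite !rank_perp; lia.
- apply/rregularP; split; [exact: above_preinj_dual | exact: below_preproj_dual].
Qed.

(** A regular submodule has positive L2, tested on its zero submodule, and a regular factor module
    has positive L1, tested on the whole of it; so an exact sequence of regular modules is a
    splitting. The converse is [splitting_exact]. *)
Lemma relementaryP m n (F : rep m n) : relementary F <-> relem F.
Proof.
split=> [[nz /rregularP[fi tp] ne]|[nz fi tp ns]].
  by split=> // /(splitting_exact fi tp).
split=> //; first exact/rregularP.
case=> v1 [v2] [w1] [w2] [S] [Q] [f1] [f2] [g1] [g2] [].
case=> hf hg /andP[fr1 fr2] /andP[fu1 fu2] /andP[/eqmxP k1 /eqmxP k2].
move=> vnz /rregularP[_ tpS] wnz /rregularP[fiQ _]; apply: ns.
have d1 : (v1 + w1 = m)%N.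
  have := mxrank_ker g1; rewrite -k1 (eqP fr1) (eqP fu1) => ->.
  by rewrite subnK // -(eqP fu1) rank_leq_row.
have d2 : (v2 + w2 = n)%N.
  have := mxrank_ker g2; rewrite -k2 (eqP fr2) (eqP fu2) => ->.
  by rewrite subnK // -(eqP fu2) rank_leq_row.
exists v1, v2; split.
- exists v1, v2, f1, f2; rewrite (eqP fr1) (eqP fr2); split=> // i.
  by rewrite -hf submxMl.
- have := tpS _ _ (has_sub0 S) vnz.
  by rewrite {2}/L2 !mulr0 !subr0.
- have := fiQ _ _ (has_sub_full Q) wnz.
  by rewrite -d1 -d2 L1D addrC addKr.
Qed.

End Elem.

(** * Modules as matrix representations *)

Section Translate.
Variable k : fieldType.
Local Notation rep := (rep k).
Implicit Types M N X : kmod k.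

Definition rep_of M : rep (dim (sp1 M)) (dim (sp2 M)) :=
  fun i => f2mx (act M (delta_mx 0 i)).

Lemma v2r_lfun (aT rT : vectType k) (f : 'Hom(aT, rT)) v :
  v2r (f v) = v2r v *m f2mx f.
Proof. by rewrite unlock /= r2vK. Qed.

Lemma eq_mulrV m n (A B : 'M[k]_(m, n)) :
  (forall v : 'rV_m, v *m A = v *m B) -> A = B.
Proof. by move=> e; apply/row_matrixP => i; rewrite !rowE. Qed.

Lemma act_sum M a u :
  act M a u = \sum_i a 0 i *: act M (delta_mx 0 i) u.
Proof.
rewrite {1}[a]row_sum_delta linear_sum sum_lfunE; apply: eq_bigr => i _.
by rewrite linearZ scale_lfunE.
Qed.

Lemma v2r_act M a u :
  v2r (act M a u) = \sum_i a 0 i *: (v2r u *m rep_of M i).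
Proof.
by rewrite act_sum linear_sum; apply: eq_bigr => i _; rewrite linearZ /= v2r_lfun.
Qed.

Lemma khom_rhom M N (f : khom M N) :
  rhom (rep_of M) (rep_of N) (f2mx (hom1 f)) (f2mx (hom2 f)).
Proof.
move=> i; apply: eq_mulrV => v; rewrite !mulmxA -[v]r2vK -!v2r_lfun.
by congr v2r; apply: hom_act.
Qed.

Lemma rhom_khom M N f1 f2 : rhom (rep_of M) (rep_of N) f1 f2 ->
  exists f : khom M N, f2mx (hom1 f) = f1 /\ f2mx (hom2 f) = f2.
Proof.
move=> h; have ha a u : (Hom f2 : 'Hom(_, _)) (act M a u) = act N a ((Hom f1 : 'Hom(_, _)) u).
  apply: v2r_inj; rewrite v2r_lfun !v2r_act mulmx_suml; apply: eq_bigr => i _.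
  by rewrite v2r_lfun /= -scalemxAl -!mulmxA h.
by exists (KHom ha).
Qed.

Lemma hom_eq0 (aT rT : vectType k) (f : 'Hom(aT, rT)) : f = 0 <-> f2mx f = 0.
Proof.
split=> [->|e]; last by apply/lfunP => u; apply: v2r_inj; rewrite v2r_lfun e mulmx0 zero_lfunE linear0.
by apply: eq_mulrV => v; rewrite -[v]r2vK -v2r_lfun zero_lfunE linear0 mulmx0.
Qed.

Lemma hom_nonzeroE M N : hom_nonzero M N <-> rhom_nz (rep_of M) (rep_of N).
Proof.
split.
  case=> f nz; exists (f2mx (hom1 f)), (f2mx (hom2 f)); split; first exact: khom_rhom.
  by case: nz => z; [left | right] => /hom_eq0.
case=> f1 [f2] [/rhom_khom [f [<- <-]] nz]; exists f.
by case: nz => z; [left | right] => /hom_eq0.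
Qed.

Lemma bij_hom_mx (aT rT : vectType k) (f : 'Hom(aT, rT)) : bijective f ->
  exists g, f2mx f *m g = 1%:M /\ g *m f2mx f = 1%:M.
Proof.
case=> h fK hK; exists (pinvmx (f2mx f)).
have fr : row_free (f2mx f).
  rewrite -kermx_eq0 -submx0; apply/rV_subP => v /sub_kermxP e.
  have : f (r2v v) = f 0 by apply: v2r_inj; rewrite linear0 v2r_lfun r2vK e linear0.
  by move/(can_inj fK)/(congr1 v2r); rewrite r2vK linear0 => ->; rewrite sub0mx.
have fu : row_full (f2mx f).
  rewrite -sub1mx; apply/rV_subP => v _; apply/submxP; exists (v2r (h (r2v v))).
  by rewrite -v2r_lfun hK r2vK.
by rewrite mulVpmx // mulmxVp.
Qed.

Lemma kiso_riso M N : kiso M N <-> riso (rep_of M) (rep_of N).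
Proof.
split.
  case=> f [/bij_hom_mx [g1 [a b]] /bij_hom_mx [g2 [c d]]].
  by exists (f2mx (hom1 f)), (f2mx (hom2 f)), g1, g2; split=> //; apply: khom_rhom.
case=> f1 [f2] [g1] [g2] [/rhom_khom [f [<- <-]] a b c d]; exists f.
split; [exists (Hom g1 : 'Hom(_, _)) | exists (Hom g2 : 'Hom(_, _))] => u;
  by apply: v2r_inj; rewrite !v2r_lfun /= -mulmxA ?a ?b ?c ?d mulmx1.
Qed.

Lemma riso_coords M m n (F : rep m n)
    (p1 : {linear sp1 M -> 'rV[k]_m}) (p2 : {linear sp2 M -> 'rV[k]_n})
    (q1 : {linear 'rV[k]_m -> sp1 M}) (q2 : {linear 'rV[k]_n -> sp2 M}) :
  cancel p1 q1 -> cancel q1 p1 -> cancel p2 q2 -> cancel q2 p2 ->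
  (forall i u, p2 (act M (delta_mx 0 i) u) = p1 u *m F i) ->
  riso (rep_of M) F.
Proof.
move=> p1K q1K p2K q2K h.
exists (lin1_mx (p1 \o r2v)), (lin1_mx (p2 \o r2v)),
  (lin1_mx (v2r \o q1)), (lin1_mx (v2r \o q2)).
split; try by [apply: eq_mulrV => v;
  rewrite mulmxA !mul_rV_lin1 /= ?v2rK ?q1K ?q2K ?p1K ?p2K ?r2vK mulmx1].
move=> i; apply: eq_mulrV => v; rewrite !mulmxA !mul_rV_lin1 /= -h.
by congr (p2 _); apply: v2r_inj; rewrite r2vK v2r_lfun r2vK.
Qed.

(** Base change in the arrow space; it turns the choice of a basis of A into the choice of an
    invertible matrix. *)
Definition twist m n (T : 'M[k]_3) (F : rep m n) : rep m n :=
  fun i => \sum_j T i j *: F j.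

Lemma rep_of_kmx m n (b : 3.-tuple (arrow_space k)) (F : rep m n) :
  riso (rep_of (kmx b F)) (twist (\matrix_(i, j) coord b j (delta_mx 0 i)) F).
Proof.
apply: (@riso_coords (kmx b F) _ _ _ idfun idfun idfun idfun) => // i u.
rewrite /= lfunE /= /kmx_lfun sum_lfunE /twist mulmx_sumr; apply: eq_bigr => j _.
by rewrite scale_lfunE lfunE /= mxE scalemxAr.
Qed.

Definition std_basis : 3.-tuple (arrow_space k) := [tuple delta_mx 0 i | i < 3].

Definition kmod_of m n (F : rep m n) : kmod k := kmx std_basis F.

Lemma std_basisE (i : 'I_3) : std_basis`_i = delta_mx 0 i.
Proof. by rewrite -tnth_nth tnth_mktuple. Qed.

Lemma std_basis_free : free std_basis.
Proof.
apply/freeP => c e i; have := congr1 (fun v : 'rV[k]_3 => v 0 i) e.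
rewrite summxE mxE (bigD1 i) //= big1 => [|j ji]; rewrite mxE std_basisE mxE.
  by rewrite !eqxx mulr1 addr0.
by rewrite eqxx eq_sym (negPf ji) mulr0.
Qed.

Lemma coord_std i (a : arrow_space k) : coord std_basis i a = a 0 i.
Proof.
rewrite {1}[a]row_sum_delta (eq_bigr (fun j => a 0 j *: std_basis`_j)).
  exact: (coord_sum_free _ _ std_basis_free).
by move=> j _; rewrite std_basisE.
Qed.

Lemma rep_of_kmod_of m n (F : rep m n) : riso (rep_of (kmod_of F)) F.
Proof.
apply: riso_trans (rep_of_kmx _ _) _; apply: riso_eq => i.
rewrite /twist (bigD1 i) //= big1 => [|j ji]; rewrite mxE coord_std mxE ?eqxx.
  by rewrite scale1r addr0.
by rewrite (negPf ji) scale0r.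
Qed.

Definition row_of_pair (U V : vectType k) (p : U * V) :=
  row_mx (v2r p.1) (v2r p.2).

Definition pair_of_row (U V : vectType k) (w : 'rV[k]_(dim U + dim V)) : U * V :=
  (r2v (lsubmx w), r2v (rsubmx w)).

Lemma row_of_pair_linear U V : linear (@row_of_pair U V).
Proof. by move=> c u v; rewrite /row_of_pair !linearP /= scale_row_mx add_row_mx. Qed.

Lemma pair_of_row_linear U V : linear (@pair_of_row U V).
Proof. by move=> c u v; rewrite /pair_of_row !linearP. Qed.

HB.instance Definition _ U V :=
  GRing.isLinear.Build k _ _ _ (@row_of_pair U V) (@row_of_pair_linear U V).
HB.instance Definition _ U V :=
  GRing.isLinear.Build k _ _ _ (@pair_of_row U V) (@pair_of_row_linear U V).

Lemma row_of_pairK U V : cancel (@row_of_pair U V) (@pair_of_row U V).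
Proof. by case=> u v; rewrite /pair_of_row row_mxKl row_mxKr !v2rK. Qed.

Lemma pair_of_rowK U V : cancel (@pair_of_row U V) (@row_of_pair U V).
Proof. by move=> w; rewrite /row_of_pair !r2vK hsubmxK. Qed.

Lemma rep_of_ksum M N : riso (rep_of (ksum M N)) (rsum (rep_of M) (rep_of N)).
Proof.
apply: (@riso_coords (ksum M N) _ _ _ (@row_of_pair _ _) (@row_of_pair _ _)
  (@pair_of_row _ _) (@pair_of_row _ _)); try exact: row_of_pairK;
  try exact: pair_of_rowK.
move=> i [u v]; rewrite ksumE /= /row_of_pair /rsum mul_row_block !mulmx0 addr0 add0r.
by rewrite !v2r_lfun.
Qed.

Lemma riso_rsum m n m' n' m1 n1 m1' n1' (F : rep m n) (F' : rep m' n')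
    (G : rep m1 n1) (G' : rep m1' n1') :
  riso F F' -> riso G G' -> riso (rsum F G) (rsum F' G').
Proof.
case=> f1 [f2] [g1] [g2] [h a b c d] [f1'] [f2'] [g1'] [g2'] [h' a' b' c' d'].
exists (block_mx f1 0 0 f1'), (block_mx f2 0 0 f2'), (block_mx g1 0 0 g1'),
  (block_mx g2 0 0 g2').
split; last 1 first.
all: try by move=> ?; rewrite /rsum !mulmx_block !mulmx0 !mul0mx !addr0 !add0r h h'.
all: rewrite !mulmx_block !mulmx0 !mul0mx !addr0 !add0r.
all: by rewrite ?a ?b ?c ?d ?a' ?b' ?c' ?d' -scalar_mx_block.
Qed.

Lemma indecomposableE M : indecomposable M <-> rindec (rep_of M).
Proof.
have kz N : kzero N <-> (dim (sp1 N) + dim (sp2 N) = 0)%N.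
  by rewrite /kzero !dimvf; split; lia.
split=> [[nz h]|[nz h]].
  split; first by rewrite lt0n; apply/eqP => /kz.
  move=> m1 n1 m2 n2 G H e.
  have e' : kiso M (ksum (kmod_of G) (kmod_of H)).
    apply/kiso_riso/(riso_trans e)/riso_sym; apply: riso_trans (rep_of_ksum _ _) _.
    by apply: riso_rsum; apply: rep_of_kmod_of.
  have dm a b (K : rep a b) : (dim (sp1 (kmod_of K)) + dim (sp2 (kmod_of K)) = a + b)%N.
    by have [-> ->] := riso_dim (rep_of_kmod_of K).
  by case: (h _ _ e') => /kz; rewrite dm; [left | right].
split; first by move/kz; lia.
move=> N N' /kiso_riso e.
by case: (h _ _ _ _ (rep_of N) (rep_of N') (riso_trans e (rep_of_ksum _ _))) => /kz;
  [left | right].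
Qed.

Lemma preprojectiveE M : preprojective M <-> rpreproj (rep_of M).
Proof.
split.
  case=> n [L h]; exists n, _, _, (fun i => rep_of (L i)) => x y Y [iY hY].
  have [|i /kiso_riso e] := h (kmod_of Y).
    split; first exact/indecomposableE/(rindec_riso (riso_sym (rep_of_kmod_of Y))).
    apply/hom_nonzeroE; apply: rhom_nz_riso hY; last exact: riso_refl.
    exact/riso_sym/rep_of_kmod_of.
  by exists i; apply: riso_trans e; apply/riso_sym/rep_of_kmod_of.
case=> n [a] [b] [L] h; exists n, (fun i => kmod_of (L i)) => X [iX hX].
have [|i e] := h _ _ (rep_of X).
  by split; [apply/indecomposableE | apply/hom_nonzeroE].
exists i; apply/kiso_riso/(riso_trans e)/riso_sym/rep_of_kmod_of.
Qed.

Lemma preinjectiveE M : preinjective M <-> rpreinj (rep_of M).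
Proof.
split.
  case=> n [L h]; exists n, _, _, (fun i => rep_of (L i)) => x y Y [iY hY].
  have [|i /kiso_riso e] := h (kmod_of Y).
    split; first exact/indecomposableE/(rindec_riso (riso_sym (rep_of_kmod_of Y))).
    apply/hom_nonzeroE; apply: rhom_nz_riso hY; first exact: riso_refl.
    exact/riso_sym/rep_of_kmod_of.
  by exists i; apply: riso_trans e; apply/riso_sym/rep_of_kmod_of.
case=> n [a] [b] [L] h; exists n, (fun i => kmod_of (L i)) => X [iX hX].
have [|i e] := h _ _ (rep_of X).
  by split; [apply/indecomposableE | apply/hom_nonzeroE].
exists i; apply/kiso_riso/(riso_trans e)/riso_sym/rep_of_kmod_of.
Qed.

(** The complement is the kernel of the retraction p, by 1 = p i + (1 - p i). *)
Lemma retract_complement m n m' n' (X : rep m n) (F : rep m' n') :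
  retract X F -> exists a b (N : rep a b), riso F (rsum X N).
Proof.
case=> i1 [i2] [p1] [p2] [hi hp e1 e2].
have s : subrep F (kermx p1) (kermx p2).
  by move=> i; apply/sub_kermxP; rewrite -mulmxA hp mulmxA mulmx_ker mul0mx.
have [N [h1 [h2 [hN /andP[fr1 fr2] /andP[/eqmxP k1 /eqmxP k2]]]]] := sub_restrict s.
exists _, _, N.
have full a b (p : 'M[k]_(a, b)) i (h : 'M_(\rank (kermx p), a)) :
    i *m p = 1%:M -> (h :=: kermx p)%MS -> row_full (col_mx i h).
  move=> e eh; rewrite -sub1mx -addsmxE (_ : 1%:M = p *m i + (1%:M - p *m i)); last first.
    by rewrite addrC subrK.
  rewrite addmx_sub //; first by rewrite (submx_trans (submxMl _ _)) ?addsmxSl.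
  rewrite (submx_trans _ (addsmxSr _ _)) // eh; apply/sub_kermxP.
  by rewrite mulmxBl mul1mx -mulmxA e mulmx1 subrr.
have free a b (p : 'M[k]_(a, b)) i (h : 'M_(\rank (kermx p), a)) :
    i *m p = 1%:M -> (h :=: kermx p)%MS -> row_free (col_mx i h).
  move=> e eh; have := full _ _ _ _ _ e eh; rewrite /row_free /row_full => /eqP ->.
  rewrite mxrank_ker; have pf : row_full p by apply/row_fullP; exists i.
  by rewrite (eqP pf) subnKC // -[X in (X <= _)%N](eqP pf) rank_leq_row.
by apply: (rsum_iso hi hN); [exact: free|exact: full|exact: free|exact: full].
Qed.

Lemma direct_summandE X M : direct_summand X M <-> retract (rep_of X) (rep_of M).
Proof.
split.
  case=> N /kiso_riso e; apply: retract_trans (retract_suml _ (rep_of N)) _.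
  apply/retract_riso/riso_sym/(riso_trans e)/rep_of_ksum.
case/retract_complement => a [b] [N] e; exists (kmod_of N).
apply/kiso_riso/(riso_trans e)/riso_sym; apply: riso_trans (rep_of_ksum _ _) _.
by apply: riso_rsum; [apply: riso_refl | apply: rep_of_kmod_of].
Qed.

Lemma retract_riso_l m n m' n' a b (X : rep m n) (X' : rep m' n') (F : rep a b) :
  riso X X' -> retract X F -> retract X' F.
Proof. by move/riso_sym/retract_riso => r; apply: retract_trans. Qed.

Lemma rregular_riso m n m' n' (F : rep m n) (F' : rep m' n') :
  riso F F' -> rregular F -> rregular F'.
Proof.
move=> e h a b X iX rX; apply: h iX _; apply: retract_trans rX _.
exact/retract_riso/riso_sym.
Qed.

Lemma regularE M : regular M <-> rregular (rep_of M).
Proof.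
split=> h.
  move=> a b X iX rX; have e := riso_sym (rep_of_kmod_of X).
  have [||np ni] := h (kmod_of X).
  - exact/indecomposableE/(rindec_riso e).
  - exact/direct_summandE/(retract_riso_l e).
  - by split=> p; [apply: np; apply/preprojectiveE/(rpreproj_riso e) |
      apply: ni; apply/preinjectiveE/(rpreinj_riso e)].
move=> X /indecomposableE iX /direct_summandE rX; have [np ni] := h _ _ _ iX rX.
by split=> [/preprojectiveE|/preinjectiveE].
Qed.

Lemma mx2vs_eq (U : vectType k) p q (A : 'M[k]_(p, dim U)) (B : 'M_(q, dim U)) :
  mx2vs A = mx2vs B :> {vspace U} <-> (A == B)%MS.
Proof.
split=> [e|/genmxP e]; last by apply: val_inj.
by apply/genmxP; have := congr1 val e.
Qed.

Lemma limg_mx (aT rT : vectType k) (f : 'Hom(aT, rT)) : limg f = mx2vs (f2mx f).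
Proof.
rewrite unlock; apply/mx2vs_eq; rewrite /= genmx1 mul1mx; apply/andP; split; exact: submx_refl.
Qed.

Lemma short_exactE M N Q (f : khom M N) (g : khom N Q) :
  short_exact f g <-> rexact (rep_of M) (rep_of N) (rep_of Q)
   (f2mx (hom1 f)) (f2mx (hom2 f)) (f2mx (hom1 g)) (f2mx (hom2 g)).
Proof.
have ker0 (aT rT : vectType k) (h : 'Hom(aT, rT)) : lker h = 0%VS <-> row_free (f2mx h).
  rewrite -kermx_eq0 /lker /vline mx2vs_eq linear0; split.
    by case/andP=> a _; rewrite -submx0; apply: (submx_trans a); apply: sub0mx.
  by move/eqP ->; rewrite !sub0mx.
have img1 (aT rT : vectType k) (h : 'Hom(aT, rT)) : limg h = fullv <-> row_full (f2mx h).
  rewrite limg_mx mx2vs_eq; split; first by case/andP => _; rewrite sub1mx.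
  by rewrite -sub1mx submx1 => ->.
have ex (aT bT rT : vectType k) (h : 'Hom(aT, bT)) (h' : 'Hom(bT, rT)) :
   limg h = lker h' <-> (f2mx h == kermx (f2mx h'))%MS.
  by rewrite limg_mx mx2vs_eq.
split.
  case=> [[/ker0 a /ker0 b] [/ex c /ex d] [/img1 u /img1 v]].
  by split; [exact: khom_rhom | exact: khom_rhom | rewrite a | rewrite u | rewrite c].
case=> _ _ /andP[a b] /andP[u v] /andP[c d].
by split; split; rewrite ?ker0 ?img1 ?ex.
Qed.

Lemma rexact_riso v1 v2 v1' v2' m n w1 w2 w1' w2' (S : rep v1 v2)
    (S' : rep v1' v2') (F : rep m n) (Q : rep w1 w2) (Q' : rep w1' w2') f1 f2 g1 g2 :
  riso S' S -> riso Q Q' -> rexact S F Q f1 f2 g1 g2 ->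
  exists f1' f2' g1' g2', rexact S' F Q' f1' f2' g1' g2'.
Proof.
case=> u1 [u2] [u1'] [u2'] [hu a1 b1 a2 b2] [t1] [t2] [t1'] [t2'] [ht c1 d1 c2 d2].
case=> hf hg /andP[fr1 fr2] /andP[fu1 fu2] /andP[/eqmxP k1 /eqmxP k2].
have free_mul a b c d (u : 'M[k]_(a, b)) (u' : 'M_(b, a)) (f : 'M_(b, c))
    (g : 'M_(c, d)) : u *m u' = 1%:M -> u' *m u = 1%:M -> row_free f ->
    (f :=: kermx g)%MS -> row_free (u *m f) /\ (u *m f :=: kermx g)%MS.
  move=> e e' fr kf; have uf : row_free u by apply/row_freeP; exists u'.
  split; first by rewrite /row_free mxrankMfree.
  apply: eqmx_trans kf; apply: eqmxMfull.
  by apply/row_fullP; exists u'.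
have full_mul a b c (g : 'M[k]_(a, b)) (t : 'M_(b, c)) t' : t *m t' = 1%:M ->
    t' *m t = 1%:M -> row_full g ->
    row_full (g *m t) /\ (kermx g :=: kermx (g *m t))%MS.
  move=> e e' fu; split.
    apply/row_fullP; case/row_fullP: fu => h eh; exists (t' *m h).
    by rewrite mulmxA -(mulmxA t') eh mulmx1.
  apply/eqmxP/andP; split; apply/sub_kermxP.
    by rewrite mulmxA mulmx_ker mul0mx.
  by rewrite -[X in _ *m X]mulmx1 -e !mulmxA -(mulmxA _ g) mulmx_ker mul0mx.
have [x1 y1] := free_mul _ _ _ _ _ _ _ _ a1 b1 fr1 k1.
have [x2 y2] := free_mul _ _ _ _ _ _ _ _ a2 b2 fr2 k2.
have [z1 w1_] := full_mul _ _ _ _ _ _ c1 d1 fu1.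
have [z2 w2_] := full_mul _ _ _ _ _ _ c2 d2 fu2.
exists (u1 *m f1), (u2 *m f2), (g1 *m t1), (g2 *m t2); split.
- exact: rhom_comp hu hf.
- exact: rhom_comp hg ht.
- by rewrite x1.
- by rewrite z1.
- by apply/andP; split; apply/eqmxP;
    [apply: eqmx_trans w1_ | apply: eqmx_trans w2_].
Qed.

Lemma elementaryE M : elementary M <-> relem (rep_of M).
Proof.
have kz N : ~ kzero N <-> (0 < dim (sp1 N) + dim (sp2 N))%N.
  rewrite /kzero !dimvf; split=> [h|h [e1 e2]]; last lia.
  by rewrite lt0n; apply/eqP => e; apply: h; lia.
rewrite -relementaryP; split.
  case=> /kz nz /regularE rM ne; split=> //.
  case=> v1 [v2] [w1] [w2] [S] [Q] [f1] [f2] [g1] [g2] [ex vz rS wz rQ].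
  have eS := rep_of_kmod_of S; have eQ := riso_sym (rep_of_kmod_of Q).
  have [f1' [f2' [g1' [g2' ex']]]] := rexact_riso eS eQ ex.
  have [hf hg _ _ _] := ex'.
  have [f [ef1 ef2]] := rhom_khom hf; have [g [eg1 eg2]] := rhom_khom hg.
  apply: ne; exists (kmod_of S), (kmod_of Q), f, g; split.
  - by apply/short_exactE; rewrite ef1 ef2 eg1 eg2.
  - by apply/kz; have [-> ->] := riso_dim eS.
  - exact/regularE/(rregular_riso (riso_sym eS)).
  - by apply/kz; have [<- <-] := riso_dim eQ.
  - exact/regularE/(rregular_riso eQ).
case=> /kz nz /regularE rM ne; split=> //.
case=> S [Q] [f] [g] [/short_exactE ex /kz vz /regularE rS /kz wz /regularE rQ].
by apply: ne; do 10!eexists; split; first exact: ex.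
Qed.

End Translate.

(** * Pencils and twists of the arrow space *)

Lemma closed_eigenvector (k : closedFieldType) n (A : 'M[k]_n) : (0 < n)%N ->
  exists a (v : 'rV_n), v != 0 /\ v *m A = a *: v.
Proof.
move=> n0; have /closed_rootP[a] : size (char_poly A) != 1 by rewrite size_char_poly eqSS -lt0n.
rewrite -eigenvalue_root_char => /eigenvalueP[v e v0]; by exists a, v.
Qed.

(** If B is invertible, an eigenvalue of A B^-1 gives the singular member; otherwise B itself is
    singular. *)
Lemma pencil_singular (k : closedFieldType) n (A B : 'M[k]_n) : (0 < n)%N ->
  exists s t (v : 'rV_n),
    [/\ (s != 0) || (t != 0), v != 0 & v *m (s *: A + t *: B) = 0].
Proof.
move=> n0; case: (boolP (row_free B)) => [fB|].
  have [C CB] : exists C, C *m B = 1%:M.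
    by apply/row_fullP; move: fB; rewrite /row_free /row_full.
  have [a [v [v0 e]]] := closed_eigenvector (A *m C) n0.
  exists 1, (- a), v; split; rewrite ?oner_eq0 //.
  have e' : v *m A = a *: (v *m B) by rewrite scalemxAl -e -!mulmxA CB mulmx1.
  by rewrite mulmxDr -!scalemxAr e' scale1r scaleNr subrr.
rewrite -kermx_eq0 => nz; exists 0, 1, (nz_row (kermx B)).
rewrite nz_row_eq0 oner_eq0 orbT; split=> //.
by rewrite scale0r add0r scale1r; apply/sub_kermxP; rewrite nz_row_sub.
Qed.

Section Lines.
Variable k : fieldType.
Local Notation rep := (rep k).

(** Its row space is A u, and its left kernel consists of the arrows annihilating u. *)
Definition vec_img m n (F : rep m n) (u : 'rV[k]_m) : 'M[k]_(3, n) :=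
  \matrix_(i < 3) (u *m F i).

Lemma mul_vec_img m n (F : rep m n) u (c : 'rV_3) :
  c *m vec_img F u = u *m (\sum_i c 0 i *: F i).
Proof.
rewrite mulmx_sum_row mulmx_sumr; apply: eq_bigr => i _.
by rewrite rowK scalemxAr.
Qed.

Lemma vec_imgP m n (F : rep m n) u a c :
  vec_img F (a *: u + c) = a *: vec_img F u + vec_img F c.
Proof.
apply/row_matrixP => i; rewrite linearP /= !rowK mulmxDl.
by rewrite -scalemxAl.
Qed.

Lemma has_sub_vec m n (F : rep m n) u : u != 0 ->
  has_sub F 1 (\rank (vec_img F u)).
Proof.
move=> u0; exists 1%N, 3, u, (vec_img F u); split=> //; last by rewrite rank_rV u0.
by move=> i; rewrite -[u *m F i](rowK (fun i => u *m F i)) row_sub.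
Qed.

Lemma has_sub_zero_divisor m n (F : rep m n) (u : 'rV_m) (c : 'rV_3) : u != 0 -> c != 0 ->
  u *m (\sum_i c 0 i *: F i) = 0 -> exists2 b, has_sub F 1 b & (b <= 2)%N.
Proof.
move=> u0 c0 e; exists (\rank (vec_img F u)); first exact: has_sub_vec.
rewrite -ltnS ltn_neqAle rank_leq_row andbT; apply/negP => fr.
move/negP: c0; apply; apply/eqP; apply: (row_free_inj fr).
by rewrite mul_vec_img e mul0mx.
Qed.

(** Such a submodule has L2 >= 1 - c > 0, so only the L1 condition can prevent a splitting. *)
Lemma relem_line m n (F : rep m n) b : relem F -> has_sub F 1 b ->
  (b <= 2)%N -> L1 m n <= L1 1 b.
Proof.
move=> [_ _ _ ns] s b2; rewrite leNgt; apply/negP => lt; apply: ns.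
exists 1%N, b; split; rewrite ?subr_gt0 //.
by have := slope_bounds; move: b2; rewrite -(ler_nat realalg) /L2; lra.
Qed.

(** A submodule with nonzero first component contains all of M_2, so only the dimension vectors (0,
    b) and (a, n) have to be tested. *)
Lemma relem_square n (F : rep n n) : (0 < n)%N ->
  (forall u, u != 0 -> row_full (vec_img F u)) -> relem F.
Proof.
move=> n0 h; have sb := slope_bounds.
have hs a b : has_sub F a b -> (0 < a)%N -> b = n.
  case=> p [q] [U1] [U2] [s <- <-] a0; apply/eqP; rewrite eqn_leq rank_leq_col.
  have u0 : nz_row U1 != 0 by rewrite nz_row_eq0 -mxrank_eq0 -lt0n.
  have /eqP {1}<- := h _ u0; apply: mxrankS; apply/row_subP => i; rewrite rowK.
  by rewrite (submx_trans _ (s i)) // submxMr // nz_row_sub.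
split; first by rewrite addn_gt0 n0.
- move=> a b s; case: (posnP a) => [->|a0].
    by rewrite add0n /L1 -(ltr_nat realalg); lra.
  rewrite (hs _ _ s a0) => _; have [an _] := has_sub_leq s.
  by move: an n0; rewrite /L1 -(ler_nat realalg) -(ltr_nat realalg); nra.
- move=> a b s; case: (posnP a) => [->|a0].
    by have := ler0n realalg b; move: n0; rewrite /L2 -(ltr_nat realalg); nra.
  rewrite (hs _ _ s a0) ltn_add2r -L2_sub; [|exact: (has_sub_leq s).1|by []].
  by rewrite subnn -subn_gt0 /L2 -(ltr_nat realalg) => lt; nra.
case=> a [b] [s]; case: (posnP a) => [->|a0].
  by rewrite /L2; have := ler0n realalg b; lra.
rewrite (hs _ _ s a0) => _; have [an _] := has_sub_leq s.
by move: an; rewrite /L1 -(ler_nat realalg); nra.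
Qed.

Lemma twist_twist m n (S T : 'M[k]_3) (F : rep m n) :
  twist S (twist T F) =1 twist (S *m T) F.
Proof.
move=> i; rewrite /twist; under eq_bigr => j _ do rewrite scaler_sumr.
rewrite exchange_big /=; apply: eq_bigr => l _; rewrite mxE scaler_suml.
by apply: eq_bigr => j _; rewrite scalerA.
Qed.

Lemma twist1 m n (F : rep m n) : twist 1%:M F =1 F.
Proof.
move=> i; rewrite /twist (bigD1 i) //= big1 => [|j ji]; rewrite mxE ?eqxx.
  by rewrite scale1r addr0.
by rewrite eq_sym (negPf ji) scale0r.
Qed.

Lemma dual_twist m n T (F : rep m n) : dual (twist T F) =1 twist T (dual F).
Proof.
move=> i; rewrite /dual /twist linear_sum; apply: eq_bigr => j _.
by rewrite linearZ.
Qed.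

Lemma has_sub_twist m n T (F : rep m n) a b :
  has_sub F a b -> has_sub (twist T F) a b.
Proof.
case=> p [q] [U1] [U2] [s <- <-]; exists p, q, U1, U2; split=> // i.
rewrite /twist mulmx_sumr summx_sub // => j _.
by rewrite -scalemxAr scalemx_sub.
Qed.

Lemma untwist m n T (F : rep m n) : T \in unitmx ->
  twist (invmx T) (twist T F) =1 F.
Proof. by move=> uT i; rewrite twist_twist mulVmx // twist1. Qed.

Lemma relem_twist m n T (F : rep m n) : T \in unitmx ->
  relem F -> relem (twist T F).
Proof.
move=> uT [nz fi tp ns].
have h a b : has_sub (twist T F) a b -> has_sub F a b.
  move=> s; apply: has_sub_riso (riso_eq (untwist F uT)) _.
  exact: has_sub_twist.
split=> // [a b /h|a b /h|[a] [b] [/h s u v]]; [exact: fi | exact: tp |].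
by apply: ns; exists a, b.
Qed.

Lemma gen_full_twist m n T (F : rep m n) : T \in unitmx ->
  gen_full F -> gen_full (twist T F).
Proof.
move=> uT gF; apply: gen_fullP => A e; apply: (stack_mul0 gF) => i.
rewrite -(untwist F uT) /twist mulmx_suml big1 // => j _.
by rewrite -scalemxAl e scaler0.
Qed.

(* The reflection is contragredient in the arrow space. *)
Lemma refl_pair_twist m n p S T (F : rep m n) (G : rep m p) :
  S^T *m T = 1%:M -> refl_pair F G -> refl_pair (twist S F) (twist T G).
Proof.
move=> ST [e gF gG d].
have [uS uT] := mulmx1_unit ST; rewrite unitmx_tr in uS.
split=> //; try exact: gen_full_twist.
have E i : (twist S F i)^T *m twist T G i
    = \sum_j \sum_l (S i j * T i l) *: ((F j)^T *m G l).
  rewrite -[(twist S F i)^T]/(dual (twist S F) i) dual_twist.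
  rewrite {1}/twist mulmx_suml; apply: eq_bigr => j _.
  rewrite /twist -scalemxAl mulmx_sumr scaler_sumr; apply: eq_bigr => l _.
  by rewrite -scalemxAr scalerA.
rewrite (eq_bigr _ (fun i _ => E i)) exchange_big /= -[RHS]e; apply: eq_bigr => j _.
rewrite exchange_big /=.
transitivity (\sum_l (S^T *m T) j l *: ((F j)^T *m G l)).
  apply: eq_bigr => l _; rewrite mxE scaler_suml; apply: eq_bigr => i _.
  by rewrite mxE.
rewrite ST (bigD1 j) //= big1 => [|l lj]; rewrite mxE ?eqxx.
  by rewrite scale1r addr0.
by rewrite eq_sym (negPf lj) scale0r.
Qed.

End Lines.

(** * Zero divisors of bilinear maps *)

Section ZeroDivisor.
Variable k : closedFieldType.
Local Notation rep := (rep k).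

(** If P + 1 were not a nonzero constant, it would have a root, where P takes the value -1. *)
Lemma poly_vanishing (P : {poly k}) : (forall x, P.[x] = 0) -> P = 0.
Proof.
move=> h; case: (altP (size (P + 1) =P 1%N)) => [/eqP/size_poly1P[c _ e]|/closed_rootP[x]].
  have eP : P = (c - 1)%:P by rewrite polyCB -e addrK.
  by have := h 0; rewrite eP hornerC => ->.
by rewrite /root hornerD h hornerC add0r oner_eq0.
Qed.

(** If the dehomogenised form has no root, it is a nonzero constant c, so that h (1, q) = c q^n and
    (1, 0) is a root. *)
Lemma binary_form_root (h : k -> k -> k) n (P Q : {poly k}) : (0 < n)%N ->
  (forall p, h p 1 = P.[p]) -> (forall q, h 1 q = Q.[q]) ->
  (forall t p q, h (t * p) (t * q) = t ^+ n * h p q) ->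
  exists p q, (p != 0) || (q != 0) /\ h p q = 0.
Proof.
move=> n0 hP hQ hh.
case: (altP (size P =P 1%N)) => [/eqP/size_poly1P[c c0 e]|/closed_rootP[x /rootP r]]; last first.
  by exists x, 1; rewrite oner_eq0 orbT hP.
exists 1, 0; rewrite oner_eq0; split=> //; rewrite hQ.
(* The identity h (1, q) = c q^n is obtained for q != 0 only; the factor X covers q = 0. *)
suff : 'X * (Q - c *: 'X^n) = 0.
  move/eqP; rewrite mulf_eq0 polyX_eq0 /= subr_eq0 => /eqP ->.
  by rewrite hornerZ hornerXn expr0n -(prednK n0) mulr0.
apply: poly_vanishing => q.
rewrite !(hornerM, hornerD, hornerN, hornerZ, hornerXn, hornerX).
case: (eqVneq q 0) => [->|q0]; first by rewrite mul0r.
have := hh q q^-1 1; rewrite mulfV // mulr1 hP e hornerC hQ => ->.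
by rewrite mulrC [c * _]mulrC subrr mul0r.
Qed.

Lemma quadratic_root (a b c : k) : a != 0 -> exists x, a * x ^+ 2 + b * x + c = 0.
Proof.
move=> a0; pose P : {poly k} := a *: 'X^2 + (b *: 'X + c%:P).
have /closed_rootP[x /rootP] : size P != 1%N.
  rewrite size_polyDl size_scale // size_polyXn //.
  apply: leq_ltn_trans (size_polyD _ _) _; rewrite gtn_max.
  rewrite (leq_ltn_trans (size_scale_leq _ _)) ?size_polyX //.
  by rewrite (leq_ltn_trans (size_polyC_leq1 _)).
by rewrite !(hornerD, hornerZ, hornerXn, hornerX, hornerC) => e; exists x; rewrite -[RHS]e addrA.
Qed.

Lemma sum_ord3 (V : zmodType) (f : 'I_3 -> V) : \sum_i f i = f 0 + f 1 + f 2%:R.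
Proof.
rewrite !big_ord_recl big_ord0 addr0 addrA; congr (_ + f _ + f _); exact: val_inj.
Qed.

Definition nonzero3 (x y z : k) := [|| x != 0, y != 0 | z != 0].

(** Stated over any commutative ring so that [sextic_root] can evaluate it at polynomials. It is s
    s' + e after Cramer's rule for s and s', multiplied by the square of the determinant p' q - q'
    p. *)
Definition sextic (R : comNzRingType)
    (b11 b12 b21 b22 e0 e1 e2 f0 f1 f2 g0 g1 g2 p q : R) : R :=
  let p' := - (p * b12 + q * b22) in
  let q' := p * b11 + q * b21 in
  let e := e2 * p ^+ 2 + e1 * (p * q) + e0 * q ^+ 2 in
  let f := f2 * p ^+ 2 + f1 * (p * q) + f0 * q ^+ 2 in
  let g := g2 * p ^+ 2 + g1 * (p * q) + g0 * q ^+ 2 in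
  (f * q - g * p) * (p' * g - q' * f) + e * (p' * q - q' * p) ^+ 2.

Lemma sextic_root (b11 b12 b21 b22 e0 e1 e2 f0 f1 f2 g0 g1 g2 : k) :
  exists p q, (p != 0) || (q != 0) /\
    sextic b11 b12 b21 b22 e0 e1 e2 f0 f1 f2 g0 g1 g2 p q = 0.
Proof.
pose S := sextic b11%:P b12%:P b21%:P b22%:P e0%:P e1%:P e2%:P f0%:P f1%:P
  f2%:P g0%:P g1%:P g2%:P.
apply: (@binary_form_root _ 6 (S 'X 1) (S 1 'X)) => // [p|q|t p q].
- by rewrite /S /sextic /= !(hornerM, hornerD, hornerN, horner_exp, hornerX, hornerC).
- by rewrite /S /sextic /= !(hornerM, hornerD, hornerN, horner_exp, hornerX, hornerC).
- by rewrite /sextic /=; ring.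
Qed.

(* Here w_ij is the product of two basis vectors a_i and u_j such that a_0 and u_0
   behave like units, and b is the pairing induced on the quotients by a_0, u_0.
   For v = (p, q) let v' = (p', q') be b-orthogonal to v. The equation
   (s a_0 + v) (s' u_0 + v') = 0 amounts to s s' + e = 0 and s v' + s' v + (f, g) = 0;
   eliminating s and s' leaves the sextic form in p and q. *)
Lemma symmetric_pairing_zero n (w00 w01 w02 w11 w12 w21 w22 : 'rV[k]_n)
    (b11 b12 b21 b22 : k) :
  (forall c11 c12 c21 c22,
    c11 * b11 + c12 * b12 + c21 * b21 + c22 * b22 = 0 ->
    exists e f g, c11 *: w11 + c12 *: w12 + c21 *: w21 + c22 *: w22
      = e *: w00 + f *: w01 + g *: w02) ->
  exists x y z x' y' z', [/\ nonzero3 x y z, nonzero3 x' y' z' &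
    (x * x') *: w00 + (x * y' + y * x') *: w01 + (x * z' + z * x') *: w02
    + ((y * y') *: w11 + (y * z') *: w12 + (z * y') *: w21 + (z * z') *: w22) = 0].
Proof.
move=> H.
case: (eqVneq (b11 * b22 - b12 * b21) 0) => [D0|D0].
  have [p [q [pq0 e1 e2]]] : exists p q, [/\ (p != 0) || (q != 0),
      p * b11 + q * b21 = 0 & p * b12 + q * b22 = 0].
    case: (boolP ((b11 == 0) && (b12 == 0))) => [/andP[/eqP z1 /eqP z2]|].
      by exists 1, 0; rewrite oner_eq0 z1 z2 !mulr0 !mul0r addr0.
    rewrite negb_and => nz; case: (boolP ((b21 == 0) && (b22 == 0))) => [/andP[/eqP z1 /eqP z2]|].
      by exists 0, 1; rewrite oner_eq0 orbT z1 z2 !mulr0 !mul0r addr0.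
    rewrite negb_and => nz2.
    case: (eqVneq b11 0) nz => [z1 /= nz|z1 _].
      exists b22, (- b12); rewrite oppr_eq0 nz orbT; split=> //; last by ring.
      by rewrite -[RHS]D0; ring.
    exists b21, (- b11); rewrite oppr_eq0 z1 orbT; split=> //; first by ring.
    by rewrite -[RHS]oppr0 -D0; ring.
  have [|a1 [f1 [g1 E1]]] := H p 0 q 0; first by rewrite !mul0r !addr0.
  have [|a2 [f2 [g2 E2]]] := H 0 p 0 q; first by rewrite !mul0r !addr0 !add0r.
  (* Degenerate pairing: v = (p, q) lies in its left radical, so v M_1 is contained in a_0 M_1. M is
     the matrix of v divided by a_0; an eigenvector u with eigenvalue l satisfies (v - l a_0) u =
     0. *)
  pose M : 'M[k]_3 := \matrix_(i, j)
    nth 0 (nth [::] [:: [:: 0; p; q]; [:: a1; f1; g1]; [:: a2; f2; g2]] i) j.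
  have [l [v [v0 ev]]] := closed_eigenvector M (isT : (0 < 3)%N).
  have ej j : v 0 0 * M 0 j + v 0 1 * M 1 j + v 0 2%:R * M 2%:R j = l * v 0 j.
    have := congr1 (fun r : 'rV_3 => r 0 j) ev.
    by rewrite [in X in X = _]mxE sum_ord3 => ->; rewrite mxE.
  have := ej 0; have := ej 1; have := ej 2%:R; rewrite !mxE /=.
  have nv : nonzero3 (v 0 0) (v 0 1) (v 0 2%:R).
    apply: contraNT v0; rewrite /nonzero3 !negb_or !negbK.
    move=> /and3P[/eqP z0 /eqP z1 /eqP z2].
    apply/eqP/rowP => i; rewrite mxE.
    case: i => [[|[|[|//]]] hi]; [rewrite -[RHS]z0|rewrite -[RHS]z1|rewrite -[RHS]z2];
      by congr (v 0 _); apply: val_inj.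
  move: (v 0 0) (v 0 1) (v 0 2%:R) nv => x0 x1 x2 nv h2 h1 h0.
  exists (- l), p, q, x0, x1, x2; split=> //; first by rewrite /nonzero3 pq0 orbT.
  apply/rowP => i; move/rowP/(_ i): E1; move/rowP/(_ i): E2; rewrite !mxE.
  move: (w00 0 i) (w01 0 i) (w02 0 i) (w11 0 i) (w12 0 i) (w21 0 i) (w22 0 i).
  move=> t00 t01 t02 t11 t12 t21 t22 e2' e1'.
  have eb : p * x1 * t11 + p * x2 * t12 + q * x1 * t21 + q * x2 * t22
    = x1 * (p * t11 + 0 * t12 + q * t21 + 0 * t22)
    + x2 * (0 * t11 + p * t12 + 0 * t21 + q * t22) by ring.
  rewrite eb e1' e2'.
  transitivity ((x0 * 0 + x1 * a1 + x2 * a2 - l * x0) * t00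
    + (x0 * p + x1 * f1 + x2 * f2 - l * x1) * t01
    + (x0 * q + x1 * g1 + x2 * g2 - l * x2) * t02); first by ring.
  by rewrite h0 h1 h2 !subrr; ring.
(* The coefficients of p^2, pq and q^2 in the product v v'; the pairing vanishes on each of them. *)
have [|e2 [f2 [g2 C2]]] := H (- b12) b11 0 0; first by ring.
have [|e1 [f1 [g1 C1]]] := H (- b22) b21 (- b12) b11; first by ring.
have [|e0 [f0 [g0 C0]]] := H 0 0 (- b22) b21; first by ring.
have [p [q [pq0]]] := sextic_root b11 b12 b21 b22 e0 e1 e2 f0 f1 f2 g0 g1 g2.
rewrite /sextic.
set p' := - (p * b12 + q * b22); set q' := p * b11 + q * b21.
set e := e2 * p ^+ 2 + _ + _; set f := f2 * p ^+ 2 + _ + _.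
set g := g2 * p ^+ 2 + _ + _; move=> E0.
have pq0' : (p' != 0) || (q' != 0).
  apply: contraTT pq0; rewrite !negb_or !negbK => /andP[/eqP z1 /eqP z2].
  have : p * (b11 * b22 - b12 * b21) = 0.
    by transitivity (q' * b22 + p' * b21); [rewrite /p' /q'; ring | rewrite z1 z2; ring].
  have : q * (b11 * b22 - b12 * b21) = 0.
    by transitivity (- p' * b11 - q' * b12); [rewrite /p' /q'; ring | rewrite z1 z2; ring].
  move=> /eqP; rewrite mulf_eq0 (negPf D0) orbF => -> /eqP.
  by rewrite mulf_eq0 (negPf D0) orbF => ->.
suff [s [s' [h0 h1 h2]]] : exists s s', [/\ s * s' + e = 0,
    s * p' + p * s' + f = 0 & s * q' + q * s' + g = 0].
  exists s, p, q, s', p', q'; split; rewrite /nonzero3 ?pq0 ?pq0' ?orbT //.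
  apply/rowP => i; move/rowP/(_ i): C2; move/rowP/(_ i): C1; move/rowP/(_ i): C0.
  rewrite !mxE.
  move: (w00 0 i) (w01 0 i) (w02 0 i) (w11 0 i) (w12 0 i) (w21 0 i) (w22 0 i).
  move=> t00 t01 t02 t11 t12 t21 t22 c0 c1 c2.
  have eb : p * p' * t11 + p * q' * t12 + q * p' * t21 + q * q' * t22
    = p ^+ 2 * (- b12 * t11 + b11 * t12 + 0 * t21 + 0 * t22)
    + p * q * (- b22 * t11 + b21 * t12 + - b12 * t21 + b11 * t22)
    + q ^+ 2 * (0 * t11 + 0 * t12 + - b22 * t21 + b21 * t22).
    by rewrite /p' /q'; ring.
  rewrite eb c0 c1 c2.
  transitivity ((s * s' + e) * t00 + (s * p' + p * s' + f) * t01
    + (s * q' + q * s' + g) * t02); first by rewrite /e /f /g; ring.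
  by rewrite h0 h1 h2; ring.
move: E0; clearbody p' q' e f g => E0.
(* Zero determinant: v' = l v, and the sextic becomes -l (f q - g p)^2. So (f, g) = m v, and what
   remains is s' = -m - l s with a quadratic equation for s. *)
case: (eqVneq (p' * q - q' * p) 0) => [d0|d0].
  have [l l0 [lp lq]] : exists2 l, l != 0 & p' = l * p /\ q' = l * q.
    case: (eqVneq p 0) pq0 => [p0 /= q0|p0 _].
      have p'0 : p' = 0.
        by move/eqP: d0; rewrite p0 mulr0 subr0 mulf_eq0 (negPf q0) orbF => /eqP.
      exists (q' / q); last by rewrite p'0 p0 mulr0 divfK.
      by move: pq0'; rewrite p'0 eqxx mulf_eq0 invr_eq0 (negPf q0) orbF.
    have e' : q' = p' / p * q.
      by apply: (mulIf p0); rewrite mulrAC divfK //; apply/esym/eqP; rewrite -subr_eq0 d0.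
    exists (p' / p); last by rewrite divfK.
    rewrite mulf_neq0 ?invr_eq0 //; apply: contraTneq pq0' => z.
    by rewrite e' z !mul0r eqxx.
  have /eqP : l * (f * q - g * p) ^+ 2 = 0.
    rewrite -[RHS]oppr0 -E0 d0 lp lq; ring.
  rewrite mulf_eq0 (negPf l0) expf_eq0 /= subr_eq0 => /eqP fg.
  have [m [fm gm]] : exists m, f = m * p /\ g = m * q.
    case: (eqVneq p 0) pq0 => [p0 /= q0|p0 _].
      have f0' : f = 0.
        by move/eqP: fg; rewrite p0 mulr0 mulf_eq0 (negPf q0) orbF => /eqP.
      by exists (g / q); rewrite f0' p0 mulr0 divfK.
    exists (f / p); rewrite divfK //; split=> //.
    by apply: (mulIf p0); rewrite mulrAC divfK.
  have [s hs] := quadratic_root m (- e) l0.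
  exists s, (- m - l * s); rewrite fm gm lp lq; split; try by ring.
  by rewrite -[RHS]oppr0 -hs; ring.
(* Cramer's rule for the two linear equations; the sextic equation then gives s s' + e = 0. *)
exists (- (f * q - g * p) / (p' * q - q' * p)), (- (p' * g - q' * f) / (p' * q - q' * p)).
split; try by field.
by apply: (mulIf (expf_neq0 2 d0)); rewrite mul0r -E0; field.
Qed.

End ZeroDivisor.

(** * Zero divisors of bilinear maps k^3 x k^3 -> k^4 *)

Section ZD.
Variable k : closedFieldType.
Local Notation rep := (rep k).

Lemma basis_extend3 (a : 'rV[k]_3) : a != 0 ->
  exists a1 a2 : 'rV_3, forall x y z,
    x *: a + y *: a1 + z *: a2 = 0 -> [/\ x = 0, y = 0 & z = 0].
Proof.
move=> a0; have [i ai] : exists i, a 0 i != 0.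
  apply/existsP; apply: contraNT a0; rewrite negb_exists => /forallP h.
  by apply/eqP/rowP => i; rewrite mxE; apply/eqP; move: (h i); rewrite negbK.
exists (delta_mx 0 (lift i 0)), (delta_mx 0 (lift i 1)) => x y z /rowP e.
have := e i; rewrite !mxE !eqxx !(negPf (neq_lift _ _)) !mulr0 !addr0.
move/eqP; rewrite mulf_eq0 (negPf ai) orbF => /eqP x0.
have := e (lift i 0); have := e (lift i 1).
rewrite !mxE x0 !mul0r !eqxx !(inj_eq (lift_inj)) /= !mulr0 !mulr1 ?add0r ?addr0.
by [].
Qed.

Lemma exists_left_ker m n (A : 'M[k]_(m, n)) : (\rank A < m)%N ->
  exists2 v : 'rV_m, v != 0 & v *m A = 0.
Proof.
move=> lt; exists (nz_row (kermx A)).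
  by rewrite nz_row_eq0 -mxrank_eq0 mxrank_ker -lt0n subn_gt0.
by apply/sub_kermxP; rewrite nz_row_sub.
Qed.

(* If phi kills A u_0 and a_0 is in the left kernel of phi (a u), then
   a_0 M_1 = ker phi = A u_0 in the absence of zero divisors, and a u_0 = a_0 (a Th)
   identifies A with M_1. *)
Lemma zero_divisor34 (F : rep 3 4) : exists (u c : 'rV[k]_3),
  [/\ u != 0, c != 0 & u *m (\sum_i c 0 i *: F i) = 0].
Proof.
apply: NNPP => no.
pose B (c u : 'rV[k]_3) := u *m (\sum_i c 0 i *: F i).
have BDl c c' u x : B (x *: c + c') u = x *: B c u + B c' u.
  rewrite /B scalemxAr -mulmxDr scaler_sumr -big_split /=; congr (_ *m _).
  by apply: eq_bigr => i _; rewrite !mxE scalerDl scalerA.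
have BDr c u u' x : B c (x *: u + u') = x *: B c u + B c u'.
  by rewrite /B mulmxDl scalemxAl.
have nz c u : B c u = 0 -> c != 0 -> u = 0.
  by move=> e c0; apply/eqP/negPn/negP => u0; apply: no; exists u, c.
have nz' c u : B c u = 0 -> u != 0 -> c = 0.
  by move=> e u0; apply/eqP/negPn/negP => c0; apply: no; exists u, c.
pose u0 : 'rV[k]_3 := delta_mx 0 0.
have u00 : u0 != 0.
  by apply/eqP => /rowP/(_ 0); rewrite !mxE eqxx => /eqP; rewrite oner_eq0.
pose K := vec_img F u0.
have KE c : c *m K = B c u0 by rewrite mul_vec_img.
have [phi phi0 Kphi] : exists2 phi : 'cV[k]_4, phi != 0 & K *m phi = 0.
  have [|v v0 ev] := @exists_left_ker _ _ K^T.
    by rewrite mxrank_tr (leq_ltn_trans (rank_leq_row _)).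
  exists v^T; first by rewrite trmx_eq0.
  by apply: trmx_inj; rewrite trmx_mul trmxK ev trmx0.
pose Phi : 'M[k]_3 := \matrix_i (F i *m phi)^T.
have PhiE c : c *m Phi = ((\sum_i c 0 i *: F i) *m phi)^T.
  rewrite mulmx_sum_row mulmx_suml linear_sum; apply: eq_bigr => i _.
  by rewrite rowK -scalemxAl linearZ.
(* [Phi] is singular since phi (A u_0) = 0 puts u_0 in its right kernel. *)
have [a0 a00 a0Phi] : exists2 a : 'rV_3, a != 0 & a *m Phi = 0.
  apply: exists_left_ker; rewrite ltn_neqAle rank_leq_row andbT -mxrank_tr.
  apply/negP => fr; move/negP: u00; apply; apply/eqP/(row_free_inj fr).
  rewrite mul0mx; apply: trmx_inj; rewrite trmx_mul trmxK trmx0.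
  apply/row_matrixP => i; rewrite row_mul rowK row0 -trmx_mul.
  have := congr1 (row i) Kphi; rewrite row_mul rowK row0 mulmxA => ->.
  by rewrite trmx0.
pose N := \sum_i a0 0 i *: F i.
have NE u : u *m N = B a0 u by [].
have Nphi : N *m phi = 0 by apply: trmx_inj; rewrite -PhiE a0Phi trmx0.
have frN : row_free N.
  rewrite -kermx_eq0 -submx0; apply/rV_subP => v /sub_kermxP e.
  by rewrite (nz a0 v) ?sub0mx.
have spanN p (w : 'M_(p, 4)) : w *m phi = 0 -> exists x, w = x *m N.
  (* The image of [N] lies in the kernel of [phi], and both have dimension 3. *)
  move=> e; apply/submxP; have s : (N <= kermx phi)%MS by apply/sub_kermxP.
  suff /eqmxP -> : (N == kermx phi)%MS by apply/sub_kermxP.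
  rewrite -(mxrank_leqif_eq s) mxrank_ker (eqP frN) -mxrank_tr rank_rV.
  by rewrite trmx_eq0 phi0.
have [Th KTh] := spanN _ _ Kphi.
have [a1 [a2 indep]] := basis_extend3 a00.
have BTh a : B a u0 = B a0 (a *m Th) by rewrite -KE KTh mulmxA.
have Th0 : a0 *m Th = u0.
  apply/eqP; rewrite -subr_eq0; apply/eqP/(nz a0) => //.
  by rewrite addrC -scaleN1r BDr scaleN1r -BTh addNr.
pose u1 := a1 *m Th; pose u2 := a2 *m Th.
have indepu x y z : x *: u0 + y *: u1 + z *: u2 = 0 -> [/\ x = 0, y = 0 & z = 0].
  rewrite /u1 /u2 -Th0 !scalemxAl -!mulmxDl => e; apply: indep; apply: (nz' _ u0) => //.
  by rewrite BTh e /B mul0mx.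
have spanu (x : 'rV_3) : exists e f g, x = e *: u0 + f *: u1 + g *: u2.
  pose U : 'M_3 := \matrix_i nth 0 [:: u0; u1; u2] i.
  have UE c : c *m U = c 0 0 *: u0 + c 0 1 *: u1 + c 0 2%:R *: u2.
    by rewrite mulmx_sum_row sum_ord3 !rowK.
  have /row_fullP[V VU] : row_full U.
    have : row_free U; last by rewrite /row_free /row_full.
    rewrite -kermx_eq0 -submx0; apply/rV_subP => v /sub_kermxP; rewrite UE.
    case/indepu => z0 z1 z2; rewrite (_ : v = 0) ?sub0mx //.
    apply/rowP => i; rewrite mxE.
    case: i => [[|[|[|//]]] hi]; [rewrite -[RHS]z0|rewrite -[RHS]z1|rewrite -[RHS]z2];
      by congr (v 0 _); apply: val_inj.
  exists ((x *m V) 0 0), ((x *m V) 0 1), ((x *m V) 0 2%:R).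
  by rewrite -UE -mulmxA VU mulmx1.
have B0l u : B 0 u = 0.
  by rewrite /B big1 ?mulmx0 // => i _; rewrite mxE scale0r.
have B0r c : B c 0 = 0 by rewrite /B mul0mx.
have Bl u x y z : B (x *: a0 + y *: a1 + z *: a2) u
    = x *: B a0 u + y *: B a1 u + z *: B a2 u.
  by rewrite -addrA BDl -[z *: a2]addr0 !BDl B0l addr0 addrA.
have Br c x y z : B c (x *: u0 + y *: u1 + z *: u2)
    = x *: B c u0 + y *: B c u1 + z *: B c u2.
  by rewrite -addrA BDr -[z *: u2]addr0 !BDr B0r addr0 addrA.
(* [phi] vanishes on A u_0 and on a_0 M_1, so it induces a pairing of the quotients; where the
   pairing is zero, the product lies in ker phi = a_0 M_1. *)
pose be c u := (B c u *m phi) 0 0.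
have [|x [y [z [x' [y' [z' [n1 n2 e]]]]]]] := @symmetric_pairing_zero k 4
    (B a0 u0) (B a0 u1) (B a0 u2) (B a1 u1) (B a1 u2) (B a2 u1) (B a2 u2)
    (be a1 u1) (be a1 u2) (be a2 u1) (be a2 u2).
  move=> c11 c12 c21 c22 e.
  have [|v ->] := spanN _ (c11 *: B a1 u1 + c12 *: B a1 u2 + c21 *: B a2 u1 + c22 *: B a2 u2).
    apply/rowP => i; rewrite (ord1 i) [RHS]mxE -[RHS]e.
    by rewrite /be !mulmxDl -!scalemxAl; do 4!move: (_ *m phi) => ?; rewrite !mxE.
  have [e' [f [g ->]]] := spanu v; exists e', f, g.
  exact: Br.
have e0 : B (x *: a0 + y *: a1 + z *: a2) (x' *: u0 + y' *: u1 + z' *: u2) = 0.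
  rewrite Bl !Br (BTh a1) (BTh a2) -/u1 -/u2 -[RHS]e.
  by apply/rowP => i; rewrite !mxE; ring.
have ne : x *: a0 + y *: a1 + z *: a2 != 0.
  apply: contraTneq n1 => /indep [-> -> ->].
  by rewrite /nonzero3 eqxx.
have /indepu [z0 z1 z2] := nz _ _ e0 ne.
by move: n2; rewrite /nonzero3 z0 z1 z2 eqxx.
Qed.

End ZD.

(** * Dimension vectors in the fundamental domain *)

Section Small.
Variable k : closedFieldType.
Local Notation rep := (rep k).

(** For n < m a single arrow has a kernel; for n = m some member of the pencil of two arrows
    does. *)
Lemma line_leq m n (F : rep m n) : (0 < n <= m)%N ->
  exists2 b, has_sub F 1 b & (b <= 2)%N.
Proof.
case/andP => n0; rewrite leq_eqVlt => /predU1P[nm|lt].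
  subst n; have [s [t [v [st v0 e]]]] := pencil_singular (F 0) (F 1) n0.
  apply: (@has_sub_zero_divisor _ _ _ F v (s *: delta_mx 0 0 + t *: delta_mx 0 1)) => //.
    apply: contraTneq st => /rowP h; have := h 0; have := h 1; rewrite !mxE /=.
    by rewrite !mulr0 !mulr1 addr0 add0r => -> ->; rewrite eqxx.
  by rewrite sum_ord3 !mxE /= !mulr0 !mulr1 !addr0 !add0r scale0r addr0.
have [|v v0 e] := @exists_left_ker _ _ _ (F 0); first exact: leq_ltn_trans (rank_leq_col _) lt.
apply: (@has_sub_zero_divisor _ _ _ F v (delta_mx 0 0)) => //.
  by apply/eqP => /rowP/(_ 0); rewrite !mxE /= => /eqP; rewrite oner_eq0.
by rewrite sum_ord3 !mxE /= scale1r !scale0r !addr0.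
Qed.

(** The pencil is parametrised by M_1 here: for u in the plane M_1, the maps a -> a u from A to M_2
    are square of size 3. *)
Lemma line_23 (F : rep 2 3) : exists2 b, has_sub F 1 b & (b <= 2)%N.
Proof.
pose e0 : 'rV[k]_2 := delta_mx 0 0; pose e1 : 'rV[k]_2 := delta_mx 0 1.
have [s [t [c [st c0 e]]]] :=
  pencil_singular (vec_img F e0) (vec_img F e1) (isT : (0 < 3)%N).
apply: (@has_sub_zero_divisor _ _ _ F (s *: e0 + t *: e1) c) => //.
  apply: contraTneq st => /rowP h; have := h 0; have := h 1; rewrite !mxE /=.
  by rewrite !mulr0 !mulr1 addr0 add0r => -> ->; rewrite eqxx.
rewrite -mul_vec_img vec_imgP -[t *: e1]addr0 vec_imgP.
rewrite [vec_img F 0](_ : _ = 0) ?addr0 //.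
by apply/row_matrixP => i; rewrite rowK mul0mx row0.
Qed.

Lemma line_34 (F : rep 3 4) : exists2 b, has_sub F 1 b & (b <= 2)%N.
Proof.
have [u [c [u0 c0 e]]] := zero_divisor34 F.
exact: has_sub_zero_divisor u0 c0 e.
Qed.

Lemma relem_fundamental m n (F : rep m n) : relem F -> (n <= m)%N ->
  (2 * m <= 3 * n)%N -> (m = 1 /\ n = 1 \/ m = 2 /\ n = 2)%N.
Proof.
move=> rF nm mn; have [nz _ _ _] := rF; have sb := slope_bounds.
have bound m' n' (G : rep m' n') b : relem G -> has_sub G 1 b -> (b <= 2)%N ->
    L1 m' n' <= 2 - slope.
  move=> rG s b2; apply: le_trans (relem_line rG s b2) _.
  by move: b2; rewrite -(ler_nat realalg) /L1; lra.
have n0 : (0 < n)%N by lia.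
have [b s b2] := line_leq F (introT andP (conj n0 nm)).
have le := bound _ _ _ _ rF s b2.
have n4 : (n < 4)%N.
  rewrite ltnNge; apply/negP => n4; move: le mn n4.
  (* With m <= 3n/2 and n >= 4, L1 is at least 4 - 6c, which exceeds 2 - c exactly because c <
     2/5. *)
  by rewrite /L1 -!(ler_nat realalg) !natrM; nra.
move/relem_dual: rF => rD.
case: n n4 nm mn nz n0 F b s b2 le rD => [//|[|[|[|//]]]] _ nm mn _ _ F b s b2 le rD.
- by left; lia.
- have : (m = 2 \/ m = 3)%N by lia.
  case=> em; first by right.
  subst m; have [b' s' b2'] := line_23 (dual F).
  by have := bound _ _ _ _ rD s' b2'; rewrite leNgt L1_23.
- have : (m = 3 \/ m = 4)%N by lia.
  case=> em; subst m; first by move: le; rewrite leNgt L1_33.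
  have [b' s' b2'] := line_34 (dual F).
  by have := bound _ _ _ _ rD s' b2'; rewrite leNgt L1_34.
Qed.

Lemma relem_11 (F : rep 1 1) : rindec F -> relem F.
Proof.
move=> iF; have gF := rindec_full iF isT.
apply: relem_square => // u u0; rewrite /row_full eqn_leq rank_leq_col lt0n mxrank_eq0.
apply: contra_neq u0 => e.
have e' i : u *m F i = 0 by rewrite -[LHS](rowK (fun i => u *m F i)) -/(vec_img F u) e row0.
rewrite [u]mx11_scalar; suff -> : u 0 0 = 0 by rewrite raddf0.
apply/eqP/negPn/negP => u00.
have : (1%:M : 'M[k]_1) = 0.
  apply: (stack_mul0 gF) => i; rewrite mulmx1.
  have := e' i; rewrite {1}[u]mx11_scalar mul_scalar_mx => /eqP.
  by rewrite scaler_eq0 (negPf u00) => /eqP.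
by move/eqP; rewrite -mxrank_eq0 mxrank1.
Qed.

(** If dim A u <= 1, the submodule generated by u has L1 at most 1 - c, less than 2 - 2c, and is
    splitting. *)
Lemma relem_22_full (F : rep 2 2) u : relem F -> u != 0 -> row_full (vec_img F u).
Proof.
move=> rF u0; rewrite /row_full eqn_leq rank_leq_col ltnNge; apply/negP => le.
have := relem_line rF (has_sub_vec F u0) (leq_trans le (leqnSn _)).
rewrite leNgt (le_lt_trans _ L1_22) // /L1 mulr1.
by move: le; rewrite -(ler_nat realalg); lra.
Qed.

(** Suppose c is a relation with c_i != 0. The pencil of the other two arrows gives some u and an
    arrow c' with c' u = 0 and i-th coordinate 0. Since A u = M_2, the arrows killing u form a line,
    which cannot contain both c and c'. *)
Lemma relem_22_indep (F : rep 2 2) (c : 'rV_3) : relem F ->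
  \sum_i c 0 i *: F i = 0 -> c = 0.
Proof.
move=> rF e; apply/eqP/negPn/negP => c0.
have [i ci] : exists i, c 0 i != 0.
  apply/existsP; apply: contraNT c0; rewrite negb_exists => /forallP h.
  by apply/eqP/rowP => i; rewrite mxE; apply/eqP; move: (h i); rewrite negbK.
pose e0 : 'rV[k]_2 := delta_mx 0 0; pose e1 : 'rV[k]_2 := delta_mx 0 1.
have [s [t [d [st d0 ed]]]] :=
  pencil_singular (row' i (vec_img F e0)) (row' i (vec_img F e1)) (isT : (0 < 2)%N).
pose u := s *: e0 + t *: e1.
have u0 : u != 0.
  apply: contraTneq st => /rowP h; have := h 0; have := h 1; rewrite !mxE /=.
  by rewrite !mulr0 !mulr1 addr0 add0r => -> ->; rewrite eqxx.
have eu : vec_img F u = s *: vec_img F e0 + t *: vec_img F e1.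
  rewrite vec_imgP -[t *: e1]addr0 vec_imgP [vec_img F 0](_ : _ = 0) ?addr0 //.
  by apply/row_matrixP => j; rewrite rowK mul0mx row0.
pose c' : 'rV[k]_3 := \row_j (if unlift i j is Some r then d 0 r else 0).
have ec' : c' *m vec_img F u = 0.
  rewrite -ed; apply/rowP => j; rewrite !mxE (bigD1_ord i) //= mxE unlift_none mul0r add0r.
  by apply: eq_bigr => r _; rewrite mxE liftK eu !mxE.
have c'0 : c' != 0.
  apply: contra_neq d0 => /rowP h; apply/rowP => r; have := h (lift i r).
  by rewrite !mxE liftK.
have ec : c *m vec_img F u = 0 by rewrite mul_vec_img e mulmx0.
have rk : \rank (kermx (vec_img F u)) = 1%N.
  by rewrite mxrank_ker (eqP (relem_22_full rF u0)).
have sc : (c <= kermx (vec_img F u))%MS by apply/sub_kermxP.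
have sc' : (c' <= kermx (vec_img F u))%MS by apply/sub_kermxP.
have /eqmxP ek : (c == kermx (vec_img F u))%MS.
  by rewrite -(mxrank_leqif_eq sc) rk rank_rV c0.
move: sc'; rewrite -ek => /sub_rVP[l el].
have := congr1 (fun r : 'rV_3 => r 0 i) el; rewrite !mxE unlift_none => /esym/eqP.
rewrite mulf_eq0 (negPf ci) orbF => /eqP l0.
by move: c'0; rewrite el l0 scale0r eqxx.
Qed.

End Small.

(** * The modules X and Y *)

Section XY.
Variable k : closedFieldType.
Local Notation rep := (rep k).

Lemma ord2_cases (i : 'I_2) : i = 0 \/ i = 1.
Proof. by case: i => [[|[|//]] hi]; [left | right]; apply: val_inj. Qed.

Lemma ord3_cases (i : 'I_3) : [\/ i = 0, i = 1 | i = 2%:R].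
Proof.
by case: i => [[|[|[|//]]] hi]; [apply: Or31 | apply: Or32 | apply: Or33];
  apply: val_inj.
Qed.

Lemma ord4_cases (i : 'I_4) : [\/ i = 0, i = 1, i = 2%:R | i = 3%:R].
Proof.
by case: i => [[|[|[|[|//]]]] hi]; [apply: Or41 | apply: Or42 | apply: Or43 | apply: Or44];
  apply: val_inj.
Qed.

Lemma sum_ord2 (V : zmodType) (f : 'I_2 -> V) : \sum_i f i = f 0 + f 1.
Proof.
by rewrite !big_ord_recl big_ord0 addr0; congr (_ + f _); apply: val_inj.
Qed.

Lemma sum_ord4 (V : zmodType) (f : 'I_4 -> V) :
  \sum_i f i = f 0 + f 1 + f 2%:R + f 3%:R.
Proof.
rewrite !big_ord_recl big_ord0 addr0 !addrA.
by congr (_ + f _ + f _ + f _); apply: val_inj.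
Qed.

Lemma sum_twist m n (T : 'M[k]_3) (F : rep m n) (c : 'rV_3) :
  \sum_i c 0 i *: twist T F i = \sum_j (c *m T) 0 j *: F j.
Proof.
rewrite /twist; under eq_bigr => i _ do rewrite scaler_sumr.
rewrite exchange_big; apply: eq_bigr => j _; rewrite mxE scaler_suml.
by apply: eq_bigr => i _; rewrite scalerA.
Qed.

Lemma X_mxE : [/\ X_mx k 0 = delta_mx 0 0 + delta_mx 1 1,
  X_mx k 1 = delta_mx 1 0 & X_mx k 2%:R = delta_mx 0 1].
Proof. by split; rewrite /X_mx (tnth_nth 0). Qed.

Lemma Y_mxE : [/\ Y_mx k 0 = delta_mx 1 0 + delta_mx 2%:R 1,
  Y_mx k 1 = delta_mx 2%:R 0 + delta_mx 3%:R 1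
  & Y_mx k 2%:R = delta_mx 0 0 + delta_mx 1 1].
Proof. by split; rewrite /Y_mx (tnth_nth 0). Qed.

Lemma delta_mx_form m n (u : 'rV[k]_m) (x : 'rV_n) i j :
  (u *m delta_mx i j *m x^T) 0 0 = u 0 i * x 0 j.
Proof.
rewrite -(mul_delta_mx (0 : 'I_1)) mulmxA -colE -mulmxA -rowE mxE big_ord1.
by rewrite !mxE.
Qed.

Lemma relem_X : relem (X_mx k).
Proof.
have [X0 X1 X2] := X_mxE.
apply: relem_square => // u u0.
suff : row_free (vec_img (X_mx k) u)^T by rewrite /row_free mxrank_tr.
rewrite -kermx_eq0 -submx0; apply/rV_subP => x /sub_kermxP e.
have e2 : vec_img (X_mx k) u *m x^T = 0.
  by apply: trmx_inj; rewrite trmx_mul trmxK trmx0.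
have ex i : (u *m X_mx k i *m x^T) 0 0 = 0.
  by have := congr1 (row i) e2; rewrite row_mul rowK row0 => ->; rewrite mxE.
have := ex 2%:R; have := ex 1; have := ex 0.
rewrite X0 X1 X2 mulmxDr mulmxDl !delta_mx_form mxE !delta_mx_form => h0 h1 h2.
suff [x0 x1] : x 0 0 = 0 /\ x 0 1 = 0.
  rewrite (_ : x = 0) ?sub0mx //; apply/rowP => i; rewrite mxE.
  by case: i => [[|[|//]] hi]; [rewrite -[RHS]x0|rewrite -[RHS]x1];
    congr (x 0 _); apply: val_inj.
case: (eqVneq (u 0 0) 0) => [z0|n0].
  have n1 : u 0 1 != 0.
    apply: contra_neq u0 => z1; apply/rowP => i; rewrite mxE.
    by case: i => [[|[|//]] hi]; [rewrite -[RHS]z0|rewrite -[RHS]z1];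
      congr (u 0 _); apply: val_inj.
  move: h0; rewrite z0 mul0r add0r => /eqP.
  rewrite mulf_eq0 (negPf n1) => /eqP; move/eqP: h1.
  by rewrite mulf_eq0 (negPf n1) => /eqP.
move/eqP: h2; rewrite mulf_eq0 (negPf n0) => /eqP x1.
by move: h0; rewrite x1 mulr0 addr0 => /eqP; rewrite mulf_eq0 (negPf n0) => /eqP.
Qed.

(* The arrows span the orthogonal complement of a matrix N for the trace form;
   N has to be invertible, and multiplication by sgn and N moves N to sgn, whose
   orthogonal complement is spanned by X_mx. *)
Lemma relem_22_X (F : rep 2 2) : relem F ->
  exists2 T, T \in unitmx & riso F (twist T (X_mx k)).
Proof.
move=> rF; have [X0 X1 X2] := X_mxE.
pose H : 'M[k]_(3, 4) := \matrix_(i, j)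
  nth 0 [:: F i 0 0; F i 0 1; F i 1 0; F i 1 1] j.
have [|v v0 ev] := @exists_left_ker _ _ _ H^T.
  by rewrite (leq_ltn_trans (rank_leq_col _)).
pose N : 'M[k]_2 := \matrix_(i, j) nth 0 (nth [::]
  [:: [:: v 0 0; v 0 2%:R]; [:: v 0 1; v 0 3%:R]] i) j.
have trN i : \tr (F i *m N) = 0.
  have := congr1 (fun r : 'rV_3 => r 0 i) ev.
  rewrite /mxtrace sum_ord2 !mxE !sum_ord2 sum_ord4 !mxE /= => h.
  by rewrite -[RHS]h; ring.
have N0 : N != 0.
  apply: contra_neq v0 => /matrixP N0; have := N0 0 0; have := N0 0 1.
  have := N0 1 0; have := N0 1 1; rewrite !mxE /= => z3 z1 z2 z0.
  by apply/rowP => i; rewrite mxE; case: (ord4_cases i) => ->.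
clearbody N.
have uN : N \in unitmx.
  apply/negPn/negP => nu.
  (* A singular N has rank 1, so N = x y, and tr (F_i N) = y F_i x = 0 for all i contradicts A y =
     M_2. *)
  have [r [x [y [er exy]]]] : exists r (x : 'M[k]_(2, r)) (y : 'M_(r, 2)),
      r = \rank N /\ x *m y = N.
    by exists (\rank N), (col_base N), (row_base N); rewrite mulmx_base.
  have r1 : r = 1%N.
    have : (\rank N <= 2)%N := rank_leq_row N.
    move: N0 nu; rewrite -mxrank_eq0 -row_free_unit /row_free -er.
    by case: (r) => [|[|[|]]].
  clear er; subst r; have y0 : y != 0 by apply: contra_neq N0 => y0; rewrite -exy y0 mulmx0.
  have /row_fullP[V VE] := relem_22_full rF y0.
  have : vec_img F y *m x = 0.
    apply/row_matrixP => i; rewrite row_mul rowK row0.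
    apply/rowP => j; rewrite [RHS]mxE (ord1 j) -[RHS](trN i) -exy.
    by rewrite mulmxA mxtrace_mulC mulmxA /mxtrace big_ord1.
  move/(congr1 (mulmx V)); rewrite mulmxA VE mul1mx mulmx0 => x0.
  by move: N0; rewrite -exy x0 mul0mx eqxx.
pose J : 'M[k]_2 := delta_mx 0 0 - delta_mx 1 1.
have JJ : J *m J = 1%:M.
  apply/matrixP => i j; rewrite mxE sum_ord2 !mxE.
  by case: (ord2_cases i) => ->; case: (ord2_cases j) => -> /=; ring.
pose G : rep 2 2 := fun i => J *m F i *m N.
have eG : riso F G.
  exists J, N, J, (invmx N); rewrite mulmxV ?mulVmx //; split=> // i.
  by rewrite /G !mulmxA JJ mul1mx.
(* As J J = 1, tr (F_i N) = tr (J G_i), which is the difference of the diagonal entries of G_i. *)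
have tG i : G i 0 0 = G i 1 1.
  apply/eqP; rewrite -subr_eq0 -(trN i) /mxtrace sum_ord2 /G !mxE !sum_ord2.
  rewrite !mxE !sum_ord2 !mxE /=; apply/eqP.
  by rewrite !subrr !subr0 !sub0r !mul0r !mul1r !add0r !addr0 !mulN1r !mulNr -opprD opprK.
have sG (c : 'rV_3) : J *m (\sum_i c 0 i *: F i) *m N = \sum_i c 0 i *: G i.
  rewrite mulmx_sumr mulmx_suml; apply: eq_bigr => i _.
  by rewrite -scalemxAr -scalemxAl.
clearbody G.
pose T : 'M[k]_3 := \matrix_(i, j) nth 0 [:: G i 0 0; G i 1 0; G i 0 1] j.
have GT i : G i = twist T (X_mx k) i.
  apply/matrixP => a b; rewrite /twist sum_ord3 X0 X1 X2 !mxE /=.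
  case: (ord2_cases a) => ->; case: (ord2_cases b) => -> /=;
  by rewrite -?tG ?addr0 ?add0r !mulr0 ?addr0 ?add0r mulr1.
exists T; last by apply: riso_trans eG (riso_eq GT).
rewrite -row_free_unit -kermx_eq0 -submx0; apply/rV_subP => c /sub_kermxP cT.
suff -> : c = 0 by rewrite sub0mx.
(* A row vector in the kernel of T is a linear relation between the G_i, hence between the F_i. *)
apply: (relem_22_indep rF).
have : J *m (J *m (\sum_i c 0 i *: F i) *m N) *m invmx N = 0.
  rewrite sG; under eq_bigr => i _ do rewrite GT.
  rewrite sum_twist cT big1 ?mulmx0 ?mul0mx // => j _.
  by rewrite mxE scale0r.
by rewrite -!mulmxA mulmxV // mulmx1 mulmxA JJ mul1mx.
Qed.

(** It exchanges beta and gamma up to sign, as the relation Y_0 X_0 - Y_1 X_2 - Y_2 X_1 = 0 between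
    the matrices of Y and X demands. *)
Definition swap_mx : 'M[k]_3 := delta_mx 0 0 - delta_mx 1 2%:R - delta_mx 2%:R 1.

Lemma swap_mx_unit : swap_mx \in unitmx.
Proof.
suff /mulmx1_unit[] : swap_mx *m swap_mx = 1%:M by [].
apply/matrixP => i j; rewrite mxE sum_ord3 !mxE.
by case: i => [[|[|[|//]]] hi]; case: j => [[|[|[|//]]] hj] /=; ring.
Qed.

Lemma refl_pair_Y_X : refl_pair (dual (Y_mx k)) (twist swap_mx (X_mx k)).
Proof.
have [X0 X1 X2] := X_mxE; have [Y0 Y1 Y2] := Y_mxE.
split=> //; last first.
- by apply: gen_full_twist swap_mx_unit _; apply: below_preproj_full; have [] := relem_X.
- apply: gen_fullP => A e; apply/row_matrixP => i; rewrite rowE row0.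
  have eY (a : 'I_2) (b : 'I_3) : (delta_mx 0 a : 'rV_2) *m (Y_mx k b)^T *m A = 0.
    by rewrite -mulmxA e mulmx0.
  have := eY 0 2%:R; have := eY 1 2%:R; have := eY 0 1; have := eY 1 1.
  rewrite Y1 Y2 !linearD /=  !trmx_delta !mul_delta_mx_cond /= !mulr0n.
  rewrite !mulr1n !addr0 !add0r => h3 h2 h1 h0.
  by case: (ord4_cases i) => ->.
- apply: etrans (sum_ord3 _) _.
  have tw i : twist swap_mx (X_mx k) i = swap_mx i 0 *: X_mx k 0 + swap_mx i 1 *: X_mx k 1
      + swap_mx i 2%:R *: X_mx k 2%:R by apply: sum_ord3.
  rewrite /dual !trmxK !tw !mxE X0 X1 X2 Y0 Y1 Y2 /=.
  rewrite !subr0 !sub0r !scale0r !scale1r !scaleN1r !addr0 !add0r !mulmxN.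
  rewrite !mulmxDl !mulmxDr !mul_delta_mx_cond /= !mulr0n !mulr1n !addr0 !add0r.
  by rewrite addrK subrr.
Qed.

Lemma relem_Y : relem (Y_mx k).
Proof.
apply: (relem_riso (riso_eq (dualK _))); apply: relem_dual.
apply: (relem_refl_pair (refl_pair_sym refl_pair_Y_X)).
exact: relem_twist swap_mx_unit relem_X.
Qed.

Lemma relem_42_Y (F : rep 4 2) : relem F ->
  exists2 T, T \in unitmx & riso F (twist T (Y_mx k)).
Proof.
move=> rF; have rD := relem_dual rF; have [_ _ tp _] := rD.
have [p [G c]] : exists p (G : rep 2 p), refl_pair (dual F) G.
  by eexists; eexists; apply/refl_pair_refl/below_preproj_full.
have ep : p = 2%N by have [_ _ _] := c; lia.
subst p; have [T uT eG] := relem_22_X (relem_refl_pair c rD).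
(* S' is chosen with S' [swap_mx] = T, and S is its contragredient, so that twisting the pair of
   [refl_pair_Y_X] by S and S' yields [twist T (X_mx k)]. *)
pose S' := T *m invmx swap_mx; pose S := (invmx S')^T.
have uS' : S' \in unitmx by rewrite unitmx_mul uT unitmx_inv swap_mx_unit.
have c1 : refl_pair (twist S (dual (Y_mx k))) (twist T (X_mx k)).
  have := @refl_pair_twist _ _ _ _ S S' _ _ _ refl_pair_Y_X.
  rewrite trmxK mulVmx // => /(_ erefl); apply: refl_pair_eqr => i.
  by rewrite twist_twist /S' -mulmxA mulVmx ?mulmx1 // swap_mx_unit.
exists S; first by rewrite unitmx_tr unitmx_inv.
have e := riso_dual (refl_pair_riso (refl_pair_sym c) (refl_pair_sym c1) eG).
apply: riso_trans (riso_dualK F) _; apply: riso_trans e _.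
apply: riso_eq => i; rewrite -(dualK (twist S (Y_mx k)) i).
by rewrite {1 3}/dual dual_twist.
Qed.

End XY.

(** * Orbits of dimension vectors *)

Lemma tau_orbit_ind (P : int * int -> Prop) q :
  P q -> (forall p, P p -> P (tau p)) -> (forall p, P p -> P (tau_inv p)) ->
  forall p, tau_orbit q p -> P p.
Proof.
move=> Pq Pt Pi p [[n|n] ->] /=; first by elim: n => //= n; apply: Pt.
by apply: (Pi); elim: n => //= n; apply: Pi.
Qed.

Lemma tau_orbit_refl q : tau_orbit q q.
Proof. by exists 0. Qed.

Lemma tau_orbit_tau q p : tau_orbit q p -> tau_orbit q (tau p).
Proof.
case=> [[n|[|n]] ->]; first by exists (Posz n.+1).
  by exists 0; rewrite /= tau_invK.
by exists (Negz n); rewrite /= tau_invK.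
Qed.

Lemma tau_orbit_tau_inv q p : tau_orbit q p -> tau_orbit q (tau_inv p).
Proof.
case=> [[[|n]|n] ->]; first by exists (Negz 0).
  by exists (Posz n); rewrite /= tauK.
by exists (Negz n.+1).
Qed.

Lemma tau_orbit_trans q r p : tau_orbit q r -> tau_orbit r p -> tau_orbit q p.
Proof.
by move=> qr; apply: tau_orbit_ind => //; [exact: tau_orbit_tau | exact: tau_orbit_tau_inv].
Qed.

Definition sigma (p : int * int) : int * int := (3 * p.1 - p.2, p.1).
Definition sigma_inv (p : int * int) : int * int := (p.2, 3 * p.2 - p.1).
Definition swap (p : int * int) : int * int := (p.2, p.1).

Lemma tauE p : tau p = sigma (sigma p).
Proof. by rewrite /tau /sigma /=; congr pair; ring. Qed.

Lemma tau_invE p : tau_inv p = sigma_inv (sigma_inv p).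
Proof. by rewrite /tau_inv /sigma_inv /=; congr pair; ring. Qed.

Lemma tau_orbit_sigma q p : tau_orbit q p -> tau_orbit (sigma q) (sigma p).
Proof.
move: p; apply: tau_orbit_ind => [|p /tau_orbit_tau|p /tau_orbit_tau_inv]; first exact: tau_orbit_refl.
  by rewrite !tauE.
rewrite (_ : tau_inv (sigma p) = sigma (tau_inv p)) //.
by rewrite /tau_inv /sigma /=; congr pair; ring.
Qed.

Lemma tau_orbit_swap q p : tau_orbit q p -> tau_orbit (swap q) (swap p).
Proof.
move: p; apply: tau_orbit_ind => [|p /tau_orbit_tau_inv|p /tau_orbit_tau]; first exact: tau_orbit_refl.
  rewrite (_ : tau_inv (swap p) = swap (tau p)) //.
rewrite (_ : tau (swap p) = swap (tau_inv p)) //.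
Qed.

Definition elementary_dim p := [\/ tau_orbit (1, 1) p, tau_orbit (2, 1) p,
  tau_orbit (2, 2) p | tau_orbit (4, 2) p].

(** [sigma] sends (1, 1) to (2, 1) and (2, 2) to (4, 2); it sends (2, 1) to (5, 2) = tau (1, 1) and
    (4, 2) to (10, 4) = tau (2, 2). *)
Lemma elementary_dim_sigma p : elementary_dim p -> elementary_dim (sigma p).
Proof.
by case=> /tau_orbit_sigma h; [apply: Or42 | apply: Or41 | apply: Or44 | apply: Or43];
  move: h => //; apply: tau_orbit_trans; exists 1.
Qed.

(** [swap] conjugates [tau] to its inverse, and it sends (2, 1) and (4, 2) to their images under
    [tau_inv]. *)
Lemma elementary_dim_swap p : elementary_dim p -> elementary_dim (swap p).
Proof.
by case=> /tau_orbit_swap h; [apply: Or41 | apply: Or42 | apply: Or43 | apply: Or44];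
  move: h => //; apply: tau_orbit_trans; exists (-1).
Qed.

(** * Dimension vectors of elementary modules, and bases of the arrow space *)

Section Main.
Variable k : closedFieldType.
Local Notation rep := (rep k).

Lemma relem_dim m n (F : rep m n) : relem F -> elementary_dim (m%:Z, n%:Z).
Proof.
move: {2}(m + n)%N (leqnn (m + n)) => N.
elim: N m n F => [|N IHN] m n F le rF; first by case: rF => nz _ _ _; lia.
have sorted x y (G : rep x y) : (x + y <= N.+1)%N -> (y <= x)%N -> relem G ->
    elementary_dim (x%:Z, y%:Z).
  move=> leG yx rG; case: (leqP (2 * x) (3 * y)) => [xy|lt].
    have [[-> ->]|[-> ->]] := relem_fundamental rG yx xy.
      exact/Or41/tau_orbit_refl.
    exact/Or43/tau_orbit_refl.
  (* Outside the fundamental domain 3y < 2x, so the reflected dual (y, 3y - x) has smaller total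
     dimension 4y - x < x + y; [sigma] leads back from it to (x, y). *)
  have rD := relem_dual rG; have [_ _ tp _] := rD.
  have c := refl_pair_refl (below_preproj_full tp); have [_ _ _ d] := c.
  have := IHN _ _ _ _ (relem_refl_pair c rD).
  set z := \rank _ in d *; rewrite (_ : (y + z <= N)%N); last lia.
  move=> /(_ isT) /elementary_dim_sigma; rewrite /sigma /=.
  by rewrite (_ : 3 * y%:Z - z%:Z = x%:Z) //; lia.
case: (leqP n m) => [nm|/ltnW mn]; first exact: sorted nm rF.
have := sorted _ _ (dual F) _ mn (relem_dual rF); rewrite addnC => /(_ le).
exact: elementary_dim_swap.
Qed.

Definition has_relem p := exists m n (F : rep m n), relem F /\ (m%:Z, n%:Z) = p.

Lemma has_relem_swap p : has_relem p -> has_relem (swap p).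
Proof. by case=> m [n] [F] [rF <-]; exists n, m, (dual F); split=> //; apply: relem_dual. Qed.

Lemma has_relem_refl x y : has_relem (x, y) -> has_relem (x, 3 * x - y).
Proof.
case=> m [n] [F] [rF [<- <-]]; have [_ _ tp _] := rF.
have c := refl_pair_refl (below_preproj_full tp); have [_ _ _ d] := c.
exists _, _, (reflection F); split; first exact: relem_refl_pair c rF.
by congr pair; set z := \rank _ in d *; lia.
Qed.

Lemma has_relem_sigma p : has_relem p -> has_relem (sigma p).
Proof. by case: p => x y /has_relem_refl /has_relem_swap. Qed.

Lemma has_relem_sigma_inv p : has_relem p -> has_relem (sigma_inv p).
Proof. by case: p => x y /has_relem_swap /has_relem_refl. Qed.

Lemma has_relem_orbit q p : has_relem q -> tau_orbit q p -> has_relem p.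
Proof.
move=> hq; apply: tau_orbit_ind => // {}p h.
  by rewrite tauE; do 2!apply: has_relem_sigma.
by rewrite tau_invE; do 2!apply: has_relem_sigma_inv.
Qed.

Lemma has_relem_elementary_dim p : elementary_dim p -> has_relem p.
Proof.
have h11 : has_relem (1, 1).
  exists 1%N, 1%N, (fun=> 1%:M); split=> //; apply: relem_square => // u u0.
  rewrite /row_full eqn_leq rank_leq_col lt0n mxrank_eq0.
  apply: contra_neq u0 => /row_matrixP /(_ 0).
  by rewrite rowK mulmx1 row0.
have h22 : has_relem (2, 2) by exists 2%N, 2%N, (X_mx k); split=> //; apply: relem_X.
case; apply: has_relem_orbit => //; [exact: has_relem_sigma h11 | exact: has_relem_sigma h22].
Qed.

(** The quadratic form is invariant under [swap] and reflection. Its value -1 excludes a zero first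
    coordinate, so an indecomposable module of this dimension is generated by M_1 and can be
    reflected. *)
Definition indec_relem (p : int * int) :=
  p.1 ^+ 2 + p.2 ^+ 2 - 3 * (p.1 * p.2) = -1 /\
  forall m n (F : rep m n), rindec F -> (m%:Z, n%:Z) = p -> relem F.

Lemma indec_relem_swap p : indec_relem p -> indec_relem (swap p).
Proof.
case=> q h; split; first by rewrite -[RHS]q /=; ring.
move=> m n F iF [em en]; apply: (relem_riso (riso_sym (riso_dualK F))).
apply/relem_dual/h; first exact: rindec_dual.
by rewrite em en; case: (p).
Qed.

Lemma indec_relem_refl x y : indec_relem (x, y) -> indec_relem (x, 3 * x - y).
Proof.
case=> /= q h; have q' : x ^+ 2 + (3 * x - y) ^+ 2 - 3 * (x * (3 * x - y)) = -1.
  by rewrite -q; ring.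
split=> // m n F iF [em en]; have m0 : (0 < m)%N.
  case: (posnP m) => // m0; move: q'; rewrite -en -em m0; nia.
have c := refl_pair_refl (rindec_full iF m0); have [_ _ _ d] := c.
apply: (relem_refl_pair (refl_pair_sym c)); apply: h (rindec_refl_pair c iF) _.
by rewrite em; congr pair; set z := \rank _ in d *; lia.
Qed.

Lemma indec_relem_sigma p : indec_relem p -> indec_relem (sigma p).
Proof. by case: p => x y /indec_relem_refl /indec_relem_swap. Qed.

Lemma indec_relem_sigma_inv p : indec_relem p -> indec_relem (sigma_inv p).
Proof. by case: p => x y /indec_relem_swap /indec_relem_refl. Qed.

Lemma indec_relem_orbit p :
  tau_orbit (1, 1) p \/ tau_orbit (2, 1) p -> indec_relem p.
Proof.
have h11 : indec_relem (1, 1).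
  by split=> // m n F iF [em en]; subst m n; apply: relem_11.
have hq q : indec_relem q -> forall p, tau_orbit q p -> indec_relem p.
  move=> h; apply: tau_orbit_ind => // {}p {}h.
    by rewrite tauE; do 2!apply: indec_relem_sigma.
  by rewrite tau_invE; do 2!apply: indec_relem_sigma_inv.
by case; apply: hq => //; apply: indec_relem_sigma h11.
Qed.

Lemma relem_22P m n (F : rep m n) : m = 2 -> n = 2 ->
  relem F <-> exists2 T, T \in unitmx & riso F (twist T (X_mx k)).
Proof.
move=> em en; subst m n; split; first exact: relem_22_X.
case=> T uT e; apply: (relem_riso (riso_sym e)).
exact: relem_twist uT (relem_X k).
Qed.

Lemma relem_42P m n (F : rep m n) : m = 4 -> n = 2 ->
  relem F <-> exists2 T, T \in unitmx & riso F (twist T (Y_mx k)).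
Proof.
move=> em en; subst m n; split; first exact: relem_42_Y.
case=> T uT e; apply: (relem_riso (riso_sym e)).
exact: relem_twist uT (relem_Y k).
Qed.

Lemma kiso_kmxE m n (G : rep m n) (M : kmod k) :
  (exists2 T, T \in unitmx & riso (rep_of M) (twist T G)) <->
  exists alpha beta gamma : arrow_space k,
    basis_of fullv [:: alpha; beta; gamma] /\
    kiso M (kmx [tuple alpha; beta; gamma] G).
Proof.
split.
  (* The rows of T^-1 form the basis in which the standard arrows have the rows of T as
     coordinates. *)
  case=> T uT e; pose b (i : 'I_3) : arrow_space k := row i (invmx T).
  pose t := [tuple b 0; b 1; b 2%:R].
  have tE (i : 'I_3) : t`_i = b i by case: (ord3_cases i) => ->.
  have ft : free t.
    apply/freeP => c e0 i; have : (\row_i c i) *m invmx T = 0.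
      rewrite mulmx_sum_row -[RHS]e0; apply: eq_bigr => j _.
      by rewrite mxE tE.
    move/(congr1 (mulmx^~ T)); rewrite mulmxKV // mul0mx.
    by move/rowP/(_ i); rewrite !mxE.
  exists (b 0), (b 1), (b 2%:R); split.
    rewrite basisEfree (_ : free _) // subvf dimvf.
    by [].
  apply/kiso_riso/(riso_trans e)/riso_sym/(riso_trans (rep_of_kmx _ _)).
  apply: riso_eq => i; apply: eq_bigr => j _; rewrite mxE; congr (_ *: _).
  have -> : delta_mx 0 i = \sum_j T i j *: t`_j.
    under eq_bigr => l _ do rewrite tE.
    have := mulmx_sum_row (row i T) (invmx T); rewrite -row_mul mulmxV // => er.
    rewrite -[LHS]row1 er; apply: eq_bigr => l _; by rewrite mxE.
  exact: coord_sum_free.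
case=> al [be [ga [bb /kiso_riso e]]]; pose t := [tuple al; be; ga].
exists (\matrix_(i, j) coord t j (delta_mx 0 i)); last first.
  exact: riso_trans e (rep_of_kmx _ _).
suff /mulmx1_unit[] : (\matrix_(i, j) coord t j (delta_mx 0 i)) *m
  (\matrix_j t`_j) = 1%:M :> 'M[k]_3 by [].
apply/row_matrixP => i; rewrite row_mul row1 mulmx_sum_row.
rewrite [RHS](coord_basis bb) ?memvf //; apply: eq_bigr => j _.
by rewrite !mxE rowK.
Qed.

End Main.

Theorem mainTheorem1 (k : closedFieldType) :
  [/\ forall p : int * int,
        (exists M : kmod k, elementary M /\ dim_vector M = p) <->
        [\/ tau_orbit (1, 1) p, tau_orbit (2, 1) p,
            tau_orbit (2, 2) p | tau_orbit (4, 2) p],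
      forall M : kmod k, indecomposable M ->
        tau_orbit (1, 1) (dim_vector M) \/ tau_orbit (2, 1) (dim_vector M) ->
        elementary M
    & (forall M : kmod k, indecomposable M -> dim_vector M = (2, 2) ->
        (elementary M <->
         exists alpha beta gamma : arrow_space k,
           basis_of fullv [:: alpha; beta; gamma] /\
           kiso M (X_module alpha beta gamma)))
      /\
      (forall M : kmod k, indecomposable M -> dim_vector M = (4, 2) ->
        (elementary M <->
         exists alpha beta gamma : arrow_space k,
           basis_of fullv [:: alpha; beta; gamma] /\
           kiso M (Y_module alpha beta gamma)))].
Proof.
have dv (M : kmod k) : dim_vector M = ((dim (sp1 M))%:Z, (dim (sp2 M))%:Z).
  by rewrite /dim_vector !dimvf.
split.
- move=> p; split; first by case=> M [/elementaryE rM <-]; rewrite dv; apply: relem_dim rM.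
  move/(has_relem_elementary_dim k) => [m [n [F [rF <-]]]].
  have e := rep_of_kmod_of F; exists (kmod_of F); split.
    exact/elementaryE/(relem_riso (riso_sym e)).
  by rewrite dv; have [-> ->] := riso_dim e.
- move=> M /indecomposableE iM /(indec_relem_orbit k) [_ h].
  by apply/elementaryE; apply: (h _ _ _ iM); rewrite dv.
- split=> M _; rewrite dv => -[em en]; rewrite elementaryE.
    by rewrite relem_22P // kiso_kmxE.
  by rewrite relem_42P // kiso_kmxE.
Qed.
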